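(* Let $(X,d_X,\odot,0_X)$ be an editable space, let $T,T'$ be $X$-valued dendrograms without degree $2$ vertices, let $x\in V_T$, $y\in V_{T'}$, and set $T_x=sub_T(x)$, $T_y=sub_{T'}(y)$. With $\mathcal K$, $F^C$, $F^D$, $F^-$, $F^S$ defined from $T_x,T_y$ as in the context, $$d_E(T_x,T_y)=\min_{\delta\in \mathcal{K}}\ F^C(\delta)+F^D(\delta)-F^-(\delta)+F^S(\delta).$$
   Context: **Editable spaces.** An editable space is a set $X$ with a metric $d_X$, an operation $\odot$ and an element $0_X$ such that: (P1) $(X,d_X)$ is a metric space; (P2) $(X,\odot,0_X)$ is a commutative monoid; (P3) $d_X(0_X,x\odot y)=d_X(0_X,x)+d_X(0_X,y)$ for all $x,y$; (P4) $d_X(x,y)=d_X(z\odot x,z\odot y)=d_X(x\odot z,y\odot z)$ for all $x,y,z$. **Dendrograms.** A tree structure $T$ is a finite connected rooted acyclic graph $(V_T,E_T)$ with root $r_T$. The relation child $<$ parent generates a partial order on $V_T$. Each edge is written $(a,b)$ with $a<b$ ($b$ the parent of $a$) and is identified with its lower vertex $a$, so $E_T\cong V_T\setminus\{r_T\}$. Leaves are vertices with no children. A ''degree $2$ vertex'' is a non-root vertex with exactly one child. An ($X$-valued) dendrogram is a tree structure $T$ with a weight function $\varphi_T:E_T\to X\setminus\{0_X\}$. Dendrograms are considered up to isomorphism of rooted trees preserving weights. For $v\in V_T$, $sub_T(v)$ is the dendrogram with vertex set $\{u\in V_T\mid u\le v\}$, root $v$, and restricted weights. For a dendrogram $S$ set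 $\|S\|=\sum_{e\in E_S}d_X(\varphi_S(e),0_X)$. **Edit distance.** The edits are: - shrinking an edge: replace its weight $a$ by another $b\in X\setminus\{0_X\}$; cost $d_X(a,b)$; - deleting an edge $(v_1,v_2)$ of weight $a$: remove $v_1$, its children becoming children of $v_2$; cost $d_X(a,0_X)$; and its inverse, the insertion of an edge of weight $a\in X\setminus\{0_X\}$ at a vertex (creating a new child, to which any, possibly empty, subset of the children of that vertex is attached), cost $d_X(a,0_X)$; - ghosting a degree $2$ vertex: remove it and join its two adjacent edges, of weights $a,b$, into one edge of weight $a\odot b$; cost $0$; and its inverse, the splitting of an edge of weight $a\odot b$ into two consecutive edges of weights $a,b\in X\setminus\{0_X\}$, cost $0$. $d_E(S,S')$ is the infimum, over all finite sequences of edits transforming $S$ into a dendrogram isomorphic to $S'$, of the sum of the costs. **Binary variables.** For $v\in V_{T_x}$ let $\zeta_v=\{v=v_0<v_1<\dots\}$ be the vertices on the path from $v$ to the root $r_{T_x}=x$, and for $v\le u$ let $\zeta_v^{u}$ be the set of vertices on the path from $v$ to $u$, extremes included; similarly in $T_y$ (with $w_0=w<w_1<\dots$). For every $v\in E_{T_x}$, $w\in E_{T_y}$, $i\geq 0$ with $v_i<r_{T_x}$ and $j\ge 0$ with $w_j<r_{T_y}$, take a binary variable $\delta^{v,w}_{i,j}\in\{0,1\}$, and write $\delta=(\delta^{v,w}_{i,j})$. **Constraints.** For $v'\in V_{T_x}$ let $\Phi(v')$ be the set of pairs $(v'',i)$ with $v''\in E_{T_x}$, $i\ge0$, $v''_i=v'<r_{T_x}$;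 similarly $\Phi(w')$ for $w'\in V_{T_y}$. $\mathcal K$ is the set of values of $\delta$ such that for each leaf $l$ of $T_x$ $$\sum_{v'\in \zeta_l}\ \sum_{(v'',i)\in \Phi(v')}\ \sum_{w,j}\delta^{v'',w}_{i,j}\le 1,$$ and for each leaf $l'$ of $T_y$ $$\sum_{w'\in \zeta_{l'}}\ \sum_{(w'',j)\in\Phi(w')}\ \sum_{v,i}\delta^{v,w''}_{i,j}\le 1 .$$ **Objective.** For $v\in E_{T_x}$ set $C(v)=\sum_{i,w,j}\delta^{v,w}_{i,j}$, $G(v)=\sum_{(v',i):\ v'<v\le v'_i}\ \sum_{w,j}\delta^{v',w}_{i,j}$, $D(v)=1-C(v)-G(v)$; define $C(w),G(w),D(w)$ analogously for $w\in E_{T_y}$. Let $$\Delta^{v,w}_{i,j}=d_X\Big(\bigodot_{v'\in \zeta_v^{v_i}}\varphi_{T_x}(v'),\ \bigodot_{w'\in \zeta_w^{w_j}}\varphi_{T_y}(w')\Big),\qquad F^C(\delta)=\sum_{v,w,i,j}\Delta^{v,w}_{i,j}\,\delta^{v,w}_{i,j},$$ $$F^D(\delta)=\sum_{v\in E_{T_x}}D(v)\,d_X(\varphi_{T_x}(v),0_X)+\sum_{w\in E_{T_y}}D(w)\,d_X(\varphi_{T_y}(w),0_X),$$ $$F^-(\delta)=\sum_{v\in E_{T_x}}C(v)\,\|sub_{T_x}(v)\|+\sum_{w\in E_{T_y}}C(w)\,\|sub_{T_y}(w)\|,$$ $$F^S(\delta)=\sum_{v,w}d_E(sub_{T_x}(v),sub_{T_y}(w))\sum_{i,j}\delta^{v,w}_{i,j}.$$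 *)

(* Defs.v *)
From mathcomp Require Import all_boot all_order all_algebra.
From mathcomp Require Import all_classical all_reals all_analysis.

Set Implicit Arguments.
Unset Strict Implicit.
Unset Printing Implicit Defensive.

Import Order.TTheory GRing.Theory Num.Theory.
Local Open Scope ring_scope.

(* [metricType] also carries the topology induced by [mdist], which is no extra
   data; [Monoid.com_law] packages associativity, commutativity and the unit. *)
Record editableSpace (R : realType) := EditableSpace {
  carrier :> metricType R ;
  ezero : carrier ;
  eop : Monoid.com_law ezero ;
  mdist0op : forall x y : carrier,
    mdist ezero (eop x y) = mdist ezero x + mdist ezero y ;
  mdist_opl : forall x y z : carrier, mdist x y = mdist (eop z x) (eop z y) ;
  mdist_opr : forall x y z : carrier, mdist x y = mdist (eop x z) (eop y z)
}.

Section Dendrograms.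
Context {R : realType} {X : editableSpace R}.

Local Notation "0_X" := (ezero X).
Local Notation "x (.) y" := (eop X x y) (at level 40, left associativity).

(* A finite rooted tree is given by its parent map, the root being its only
   fixpoint; the edges are the pairs (v, parent v) with v != root. An edge is
   identified with its lower vertex v and its weight is [wt v]; the root carries
   no edge and gets the conventional weight 0_X, so that the last axiom says
   exactly that edges have nonzero weights. *)
Record dendrogram := Dendrogram {
  vert :> finType ;
  root : vert ;
  parent : vert -> vert ;
  wt : vert -> X ;
  parent_root : parent root = root ;
  to_root : forall v, fconnect parent v root ;
  wt_eq0 : forall v, (wt v == 0_X) = (v == root)
}.

Arguments root : clear implicits.
Arguments parent {d} v.
Arguments wt {d} v.

Section Vertices.
Variable S : dendrogram.
Implicit Types u v : S.

(* the i-th vertex v_i on the path from v to the root (constant, equal to the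
   root, once the root is reached) *)
Definition anc v (i : nat) : S := iter i parent v.

Definition vle u v : bool := fconnect parent u v.
Definition vlt u v : bool := (u != v) && vle u v.

Definition child u v : bool := (u != root S) && (parent u == v).
Definition leaf v : bool := [forall u, ~~ child u v].
Definition degree2 v : bool := (v != root S) && (#|[set u | child u v]| == 1%N).

Definition dnorm : R := \sum_(v | v != root S) mdist (wt v) 0_X.

Lemma anc_bound v i : anc v i != root S -> (i < #|S|)%N.
Proof.
move=> vi; apply: (@leq_trans (order parent v)); last exact: max_card.
apply: leq_trans (findex_max (to_root v)); rewrite ltnS leqNgt.
apply: contra vi => /ltnW lei; rewrite /anc -(subnK lei) iterD iter_findex ?to_root//.
by elim: (_ - _)%N => //= n /eqP ->; rewrite parent_root.
Qed.

End Vertices.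

Section Sub.
Variables (S : dendrogram) (v : S).

Definition sub_vert : finType := {u : S | vle u v}.

Definition sub_root : sub_vert := exist (fun u : S => vle u v) v (connect0 _ v).

Lemma sub_parent_subproof (u : sub_vert) :
  vle (if val u == v then v else parent (val u)) v.
Proof.
case: eqP => [_|/eqP uv]; first exact: connect0.
rewrite /vle; have := iter_findex (valP u).
case: (findex _ _ _) => [/= e|n]; first by case/eqP: uv.
by rewrite iterSr => e; rewrite -[X in fconnect _ _ X]e; exact: fconnect_iter.
Qed.

Definition sub_parent (u : sub_vert) : sub_vert :=
  exist (fun u : S => vle u v) _ (sub_parent_subproof u).

Definition sub_wt (u : sub_vert) : X :=
  if u == sub_root then 0_X else wt (val u).

Lemma sub_parent_root : sub_parent sub_root = sub_root.
Proof. by apply: val_inj; rewrite /= eqxx. Qed.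

Lemma sub_to_root u : fconnect sub_parent u sub_root.
Proof.
have [n] : exists n, iter n parent (val u) = v.
  by exists (findex parent (val u) v); exact: iter_findex (valP u).
elim: n u => [|n IHn] u.
  by move=> /= uv; rewrite (_ : u = sub_root) ?connect0//; apply: val_inj.
have [uv _|uv] := eqVneq (val u) v.
  by rewrite (_ : u = sub_root) ?connect0//; apply: val_inj.
rewrite iterSr => e; apply: connect_trans (fconnect1 _ _) (IHn _ _).
by rewrite /= (negbTE uv).
Qed.

Lemma sub_wt_eq0 u : (sub_wt u == 0_X) = (u == sub_root).
Proof.
rewrite /sub_wt; have [_|uv] := eqVneq u sub_root; first by rewrite eqxx.
rewrite wt_eq0; apply: contraNF uv => /eqP ur; apply/eqP/val_inj => /=.
rewrite ur; apply: etrans (iter_findex (valP u)); rewrite ur.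
by elim: (findex _ _ _) => //= n <-; rewrite parent_root.
Qed.

Definition sub : dendrogram :=
  Dendrogram sub_parent_root sub_to_root sub_wt_eq0.

End Sub.

Definition no_degree2 (S : dendrogram) : Prop := forall v : S, ~~ degree2 v.

(* All edits are taken up to isomorphism: they are described by a map from the
   vertices of the resulting dendrogram S' to those of S. *)

Definition tree_iso (S S' : dendrogram) (f : S' -> S) : Prop :=
  [/\ bijective f, f (root S') = root S & forall u, f (parent u) = parent (f u)].

Definition isomorphic (S S' : dendrogram) : Prop :=
  exists2 f : S' -> S, tree_iso f & forall u, wt u = wt (f u).

(* The weight of the edge v is replaced by b. *)
Definition shrinks (S : dendrogram) (v : S) (b : X) (S' : dendrogram) : Prop :=
  v != root S /\
  exists2 f : S' -> S, tree_iso f &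
    forall u, wt u = if f u == v then b else wt (f u).

(* S' is the tree S with v removed, the children of v becoming children of the
   parent of v (no condition on weights). *)
Definition tree_removal (S : dendrogram) (v : S) (S' : dendrogram)
    (f : S' -> S) : Prop :=
  [/\ injective f,
      forall s, (s != v) <-> exists u, f u = s,
      f (root S') = root S
    & forall u,
        f (parent u) = if parent (f u) == v then parent v else parent (f u)].

Definition deletes (S : dendrogram) (v : S) (S' : dendrogram) : Prop :=
  v != root S /\
  exists2 f : S' -> S, tree_removal v f & forall u, wt u = wt (f u).

Definition ghosts (S : dendrogram) (v : S) (S' : dendrogram) : Prop :=
  degree2 v /\
  exists2 f : S' -> S, tree_removal v f &
    forall u, wt u = if child (f u) v then wt (f u) (.) wt v else wt (f u).

Inductive edit : dendrogram -> dendrogram -> R -> Prop :=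
| Shrink (S S' : dendrogram) (v : S) b : shrinks v b S' -> edit S S' (mdist (wt v) b)
| Delete (S S' : dendrogram) (v : S) : deletes v S' -> edit S S' (mdist (wt v) 0_X)
| Insert (S S' : dendrogram) (v : S') : deletes v S -> edit S S' (mdist (wt v) 0_X)
| Ghost (S S' : dendrogram) (v : S) : ghosts v S' -> edit S S' 0
| Split (S S' : dendrogram) (v : S') : ghosts v S -> edit S S' 0.

Inductive edit_path : dendrogram -> dendrogram -> R -> Prop :=
| EditNil (S S' : dendrogram) : isomorphic S S' -> edit_path S S' 0
| EditCons (S1 S2 S3 : dendrogram) c c' :
    edit S1 S2 c -> edit_path S2 S3 c' -> edit_path S1 S3 (c + c').

Definition dE (S S' : dendrogram) : R :=
  inf [set c : R | edit_path S S' c]%classic.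

(* The pairs (v, i) with v_i < root, which forces v != root; by [anc_bound] the
   bound i < #|S| excludes none of them. *)
Definition segment (S : dendrogram) : finType :=
  {p : S * 'I_#|S| | anc p.1 p.2 != root S}.

Section Segments.
Variable S : dendrogram.

Definition bot (p : segment S) : S := (val p).1.
Definition top (p : segment S) : S := anc (val p).1 (val p).2.

Definition Phi (v : S) : {set segment S} := [set p | top p == v].

Definition seg_wt (p : segment S) : X :=
  \big[eop X/0_X]_(v | vle (bot p) v && vle v (top p)) wt v.

(* Below, m p stands for the sum of the variables delta over all the pairs
   involving the segment p. *)
Variable m : segment S -> nat.

Definition leaf_constraint : bool :=
  [forall l : S, leaf l ==>
    (\sum_(v | vle l v) \sum_(p in Phi v) m p <= 1)%N].

Definition Cvar (v : S) : R := (\sum_(p | bot p == v) m p)%N%:R.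
Definition Gvar (v : S) : R :=
  (\sum_(p | vlt (bot p) v && vle v (top p)) m p)%N%:R.
Definition Dvar (v : S) : R := 1 - Cvar v - Gvar v.

Definition FD_half : R := \sum_(v | v != root S) Dvar v * mdist (wt v) 0_X.
Definition Fm_half : R := \sum_(v | v != root S) Cvar v * dnorm (sub v).

End Segments.

Section Program.
Variables Tx Ty : dendrogram.

(* delta (p, q) is the variable delta^{v,w}_{i,j} for p = (v, i), q = (w, j). *)
Definition variables : finType := {ffun segment Tx * segment Ty -> bool}.

Implicit Type delta : variables.

Definition marg1 delta (p : segment Tx) : nat := (\sum_q delta (p, q))%N.
Definition marg2 delta (q : segment Ty) : nat := (\sum_p delta (p, q))%N.

Definition K : {set variables} :=
  [set delta | leaf_constraint (marg1 delta) && leaf_constraint (marg2 delta)].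

Definition FC delta : R :=
  \sum_p \sum_q mdist (seg_wt p) (seg_wt q) * (delta (p, q))%:R.

Definition FD delta : R := FD_half (marg1 delta) + FD_half (marg2 delta).

Definition Fm delta : R := Fm_half (marg1 delta) + Fm_half (marg2 delta).

Definition FS delta : R :=
  \sum_(v | v != root Tx) \sum_(w | w != root Ty)
    dE (sub v) (sub w) *
    (\sum_(p | bot p == v) \sum_(q | bot q == w) delta (p, q))%N%:R.

End Program.

End Dendrograms.

Arguments dendrogram {R} X.
Arguments K {R X} Tx Ty.

(* Main.v *)
From mathcomp Require Import all_boot all_order all_algebra.
From mathcomp Require Import all_classical all_reals all_analysis.
From mathcomp Require Import fintype finset lra.
Require Import Defs.


(** Deleting every edge of [S] and inserting every edge of [S'] costs
    [dnorm S + dnorm S'], so an edit path is best measured by what it saves on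
    this amount. Write [enorm x] for the distance from [x] to [0_X] and
    [gain x y = enorm x + enorm y - mdist x y]. By (P3) and (P4) the gain is
    nonnegative, superadditive for the monoid operation, and null when one of its
    arguments is [0_X].

    A coupling of [S] and [S'] gives labels to some of their edges. The edges with
    the label [i] form a chain [A i] in [S] and a chain [B i] in [S'], and the order
    between edges with different labels is the same in both trees. Its total gain is
    the sum over [i] of [gain (mass (A i)) (mass (B i))], where the mass of a set is
    the product of its weights. A label on one side only has gain 0, so that its
    edges count as deleted. The edit distance turns out to be the least value of
    [dnorm S + dnorm S'] minus a total gain:
    - every edit path gives a coupling with at least its savings
      ([matching_of_path]), because a coupling of [S2] with [S3] can be pulled back
      along an edit from [S1] to [S2] at the price of the edit
      ([edit_transfers]). The delicate edit is the splitting of an edge into two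
      edges with different labels: the two labels are adjacent in both trees, so
      they can be merged ([coupling_merge]) and superadditivity pays for it;
    - every coupling is realised by an edit path ([path_of_coupling]): delete the
      edges without label, ghost inside the chains, and what remains is an
      isomorphism of trees, up to shrinking.

    In the same way the objective is [dnorm Tx + dnorm Ty] minus the sum, over the
    pairs of segments with variable 1, of the gain of the two segments plus the
    savings on the two subtrees below them ([objectiveE]), and the leaf constraints
    say that the segments so chosen have pairwise incomparable tops
    ([leaf_constraintP]). Near-optimal couplings of the subtrees, with one more label
    for each pair of segments, are glued into a coupling of the trees
    ([coupling_glue]); hence no value of the objective is below the distance.
    Conversely, the outermost labels of a coupling span segments which give a point
    of [K]. Filling up a chain to a segment increases its gain, and the labels below
    the chain form a coupling of the subtrees ([variables_of_coupling]); hence the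
    least value of the objective over the finite set [K] is at most the distance. *)

Set Implicit Arguments.
Unset Strict Implicit.
Unset Printing Implicit Defensive.

Import Order.TTheory GRing.Theory Num.Theory.
Local Open Scope ring_scope.

Arguments parent {R X d} v.
Arguments wt {R X d} v.

(** * Gains in an editable space *)

Section EditableSpace.
Context {R : realType} {X : editableSpace R}.
Implicit Types x y z : X.

Local Notation "x (.) y" := (eop X x y) (at level 40, left associativity).

Definition enorm x : R := mdist x (ezero X).

Definition gain x y : R := enorm x + enorm y - mdist x y.

Lemma enorm_ge0 x : 0 <= enorm x.
Proof. exact: mdist_ge0. Qed.

Lemma enorm0 : enorm (ezero X) = 0.
Proof. exact: mdistxx. Qed.

Lemma enorm_op x y : enorm (x (.) y) = enorm x + enorm y.
Proof. by rewrite /enorm !(metric_sym _ (ezero X)) mdist0op. Qed.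

Lemma mdist_le_enorm x y : mdist x y <= enorm x + enorm y.
Proof.
by rewrite /enorm (metric_sym y); exact: metric_triangle.
Qed.

Lemma mdist_op x x' y y' :
  mdist (x (.) x') (y (.) y') <= mdist x y + mdist x' y'.
Proof.
apply: le_trans (metric_triangle _ (y (.) x') _) _.
by rewrite -mdist_opr -mdist_opl.
Qed.

Lemma gain_ge0 x y : 0 <= gain x y.
Proof. by rewrite subr_ge0 mdist_le_enorm. Qed.

Lemma gainC x y : gain x y = gain y x.
Proof. by rewrite /gain metric_sym [enorm x + _]addrC. Qed.

Lemma gain0l y : gain (ezero X) y = 0.
Proof. by rewrite /gain enorm0 metric_sym add0r subrr. Qed.

Lemma gain0r x : gain x (ezero X) = 0.
Proof. by rewrite gainC gain0l. Qed.

(** Norms are additive and distances subadditive, so merging two couplings of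
    weights into one loses nothing. *)
Lemma gain_op x x' y y' :
  gain x y + gain x' y' <= gain (x (.) x') (y (.) y').
Proof. rewrite /gain !enorm_op; have := mdist_op x x' y y'; lra. Qed.

Lemma gain_opl x a y : gain x y <= gain (x (.) a) y.
Proof.
rewrite -[leLHS]addr0 -{1}(gain0r a) -{2}(Monoid.mulm1 (eop X) y).
exact: gain_op.
Qed.

Lemma gain_opr x y a : gain x y <= gain x (y (.) a).
Proof. by rewrite !(gainC x) gain_opl. Qed.

Lemma mdist_op0 x a : mdist (x (.) a) x = enorm a.
Proof.
by rewrite -{2}(Monoid.mulm1 (eop X) x) -mdist_opl.
Qed.

(** The price of removing one edge from a chain: its own deletion, and the share of
    its norm in the sum of all norms. *)
Lemma gain_opl_le x a y : gain (x (.) a) y <= gain x y + 2 * enorm a.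
Proof.
rewrite /gain enorm_op; have := metric_triangle x (x (.) a) y.
rewrite (metric_sym x (x (.) a)) mdist_op0; lra.
Qed.

(** The price of replacing the weight [a] by [b] in a chain; the difference of norms
    accounts for the change of the total norm of the tree. *)
Lemma gain_opl_lip x a b y :
  gain (x (.) b) y <= gain (x (.) a) y + (enorm b - enorm a + mdist a b).
Proof.
rewrite /gain !enorm_op; have := metric_triangle (x (.) a) (x (.) b) y.
rewrite -mdist_opl; lra.
Qed.

Lemma enorm_prod (I : finType) (P : pred I) (F : I -> X) :
  enorm (\big[eop X/ezero X]_(i | P i) F i) = \sum_(i | P i) enorm (F i).
Proof. exact: (big_morph enorm enorm_op enorm0). Qed.

End EditableSpace.

(** * The order of a rooted tree *)

Section TreeOrder.
Context {R : realType} {X : editableSpace R}.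
Variable S : dendrogram X.
Implicit Types u v w : S.

Local Notation root := (root S).

Lemma vleP u v : reflect (exists n, iter n parent u = v) (vle u v).
Proof.
apply: (iffP idP) => [/iter_findex|[n <-]]; last exact: fconnect_iter.
by exists (findex parent u v).
Qed.

Lemma vle_refl u : vle u u. Proof. exact: connect0. Qed.
#[local] Hint Resolve vle_refl : core.

Lemma vle_trans : transitive (@vle R X S).
Proof. exact: connect_trans. Qed.

Lemma vle_root u : vle u root. Proof. exact: to_root. Qed.

Lemma vle_parent u : vle u (parent u). Proof. exact: fconnect1. Qed.

Lemma iter_parent_root n : iter n parent root = root.
Proof. by elim: n => //= n ->; rewrite parent_root. Qed.

Lemma root_vle u : vle root u = (u == root).
Proof.
apply/idP/eqP => [/vleP[n <-]|->]//; exact: iter_parent_root.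
Qed.

Lemma vle_anti u v : vle u v -> vle v u -> u = v.
Proof.
move=> /vleP[n un] /vleP[m vm].
case: n un => [//|n] un.
have {}vm : iter (m + n.+1) parent u = u by rewrite iterD un.
have cyc k : iter (k * (m + n.+1)) parent u = u.
  by elim: k => //= k IHk; rewrite mulSn iterD IHk.
have /vleP[k uk] := vle_root u.
have ur : u = root.
  rewrite -(cyc k) -[X in iter X](@subnK k) ?iterD ?uk ?iter_parent_root//.
  by rewrite addnS leq_pmulr.
by rewrite -un ur iter_parent_root.
Qed.

Lemma vle_up u v w : vle u v -> vle u w -> vle v w || vle w v.
Proof.
move=> /vleP[n <-] /vleP[m <-].
have [nm|mn] := leqP n m.
  apply/orP; left; apply/vleP; exists (m - n)%N.
  by rewrite -iterD subnK.
apply/orP; right; apply/vleP; exists (n - m)%N.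
by rewrite -iterD subnK// ltnW.
Qed.

Lemma vle_parentE u v : vle u v = (u == v) || vle (parent u) v.
Proof.
apply/idP/orP => [/vleP[[/= ->|n]]|[/eqP->//|]]; first by left.
- by rewrite iterSr => nv; right; apply/vleP; exists n.
- by apply: vle_trans; exact: vle_parent.
Qed.

Lemma vle_neq_parent u v : u != v -> vle u v = vle (parent u) v.
Proof. by move=> /negbTE uv; rewrite vle_parentE uv. Qed.

Lemma parent_neq u : u != root -> parent u != u.
Proof.
apply: contraNN => /eqP pu; have /vleP[n] := vle_root u.
by elim: n => [/= ->//|n IHn]; rewrite iterSr pu.
Qed.

Lemma parent_vleN u : u != root -> ~~ vle (parent u) u.
Proof.
move=> ur; apply: contra (parent_neq ur) => pu.
by apply/eqP/vle_anti => //; exact: vle_parent.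
Qed.

Definition height u : nat := #|[set w | vle w u]|.

Lemma height_lt u v : vle u v -> u != v -> (height u < height v)%N.
Proof.
move=> uv neq; apply/proper_card/properP; split.
  by apply/fintype.subsetP => w; rewrite !inE => wu; exact: vle_trans wu uv.
exists v; rewrite !inE//; apply: contra neq => vu.
by apply/eqP/vle_anti.
Qed.

Lemma leaf_below v : exists2 l, leaf l & vle l v.
Proof.
have [n] := ubnP (height v); elim: n v => // n IHn v; rewrite ltnS => hv.
have [lv|] := boolP (leaf v); first by exists v.
rewrite negb_forall => /existsP[u]; rewrite negbK => /andP[ur /eqP uv].
have le_uv : vle u v by rewrite -uv vle_parent.
have [|l ll lu] := IHn u.
  by apply: leq_trans hv; rewrite height_lt// -uv eq_sym parent_neq.
by exists l => //; exact: vle_trans le_uv.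
Qed.

End TreeOrder.

#[local] Hint Resolve vle_refl : core.

(** * Couplings of two dendrograms *)

Section Couplings.
Context {R : realType} {X : editableSpace R}.
Implicit Types S : dendrogram X.

Local Notation "0_X" := (ezero X).
Local Notation "x (.) y" := (eop X x y) (at level 40, left associativity).

Definition mass S (A : {set S}) : X := \big[eop X/0_X]_(u in A) wt u.

(** The root carries no edge and is excluded. Members may be empty. *)
Record chains S (I : finType) (A : I -> {set S}) : Prop := Chains {
  chains_root : forall i, root S \notin A i ;
  chains_disj : forall i j u, u \in A i -> u \in A j -> i = j ;
  chains_cmp : forall i u v, u \in A i -> v \in A i -> vle u v || vle v u
}.

(** The two sides of the equality vary independently, so this also forbids branching
    inside a chain: a labelled edge below one edge of [A i] is below the whole
    chain, if both labels occur on the other side as well. *)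
Definition compatible S S' (I : finType) (A : I -> {set S}) (B : I -> {set S'}) :=
  forall i j u u' w w', i != j -> u \in A i -> u' \in A j ->
    w \in B i -> w' \in B j -> vle u u' = vle w w'.

Definition coupling S S' (I : finType) (A : I -> {set S}) (B : I -> {set S'}) :=
  [/\ chains A, chains B & compatible A B].

Definition total_gain S S' (I : finType) (A : I -> {set S}) (B : I -> {set S'}) : R :=
  \sum_i gain (mass (A i)) (mass (B i)).

(** A coupling together with its type of labels, so that one can quantify over all
    couplings of two dendrograms. *)
Record matching S S' := Matching {
  label : finType ;
  lpart : label -> {set S} ;
  rpart : label -> {set S'} ;
  matchingP : coupling lpart rpart
}.

Definition mgain S S' (M : matching S S') := total_gain (@lpart _ _ M) (@rpart _ _ M).

Lemma mass0 S : mass (set0 : {set S}) = 0_X.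
Proof. exact: big_set0. Qed.

Lemma massD1 S (A : {set S}) v : v \in A -> mass A = mass (A :\ v) (.) wt v.
Proof. by move=> vA; rewrite /mass (big_setD1 v)//= Monoid.mulmC. Qed.

Lemma massU1 S (A : {set S}) v : v \notin A -> mass (v |: A) = mass A (.) wt v.
Proof. by move=> vA; rewrite /mass big_setU1//= Monoid.mulmC. Qed.

Lemma mass_subset S (A B : {set S}) :
  A \subset B -> mass B = mass A (.) mass (B :\: A).
Proof.
move=> AB; rewrite /mass (big_setID A)/= (_ : B :&: A = A)//.
exact/finset.setIidPr.
Qed.

Lemma mass_imset S S' (f : S' -> S) (A : {set S'}) : injective f ->
  mass (f @: A) = \big[eop X/0_X]_(u in A) wt (f u).
Proof. by move=> fI; rewrite /mass big_imset//= => x y _ _; exact: fI. Qed.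

Lemma dnormE S : dnorm S = \sum_(v : S) enorm (wt v).
Proof.
rewrite (bigD1 (root S))//= (_ : wt (root S) = 0_X) ?enorm0 ?add0r//.
by apply/eqP; rewrite wt_eq0.
Qed.

Lemma coupling_sym S S' (I : finType) (A : I -> {set S}) (B : I -> {set S'}) :
  coupling A B -> coupling B A.
Proof.
by case=> cA cB AB; split=> // i j w w' u u' ij wi wj ui uj; apply: esym; apply: AB ij _ _ _ _.
Qed.

Lemma total_gain_sym S S' (I : finType) (A : I -> {set S}) (B : I -> {set S'}) :
  total_gain A B = total_gain B A.
Proof. by apply: eq_bigr => i _; rewrite gainC. Qed.

Lemma chains_sub S (I : finType) (A A' : I -> {set S}) :
  (forall i, A' i \subset A i) -> chains A -> chains A'.
Proof.
move=> sA [r d c]; have s i : {subset A' i <= A i} := fintype.subsetP (sA i).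
split=> [i|i j u /s ui /s uj|i u v /s ui /s vi].
- by apply: contra (r i); exact: s.
- exact: d ui uj.
- exact: c ui vi.
Qed.

Lemma coupling_sub S S' (I : finType) (A A' : I -> {set S}) (B B' : I -> {set S'}) :
  (forall i, A' i \subset A i) -> (forall i, B' i \subset B i) ->
  coupling A B -> coupling A' B'.
Proof.
move=> sA sB [cA cB AB]; split; [exact: chains_sub cA|exact: chains_sub cB|].
move=> i j u u' w w' ij ui uj wi wj.
by apply: AB ij _ _ _ _; rewrite ?(fintype.subsetP (sA _))// ?(fintype.subsetP (sB _)).
Qed.

(** A vertex has one label at most, so a bound on the effect of this vertex on one
    label bounds its effect on a sum over all labels. *)
Lemma chains_sum_le S (I : finType) (A : I -> {set S}) v (e : R) :
  chains A -> 0 <= e -> \sum_i (v \in A i)%:R * e <= e.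
Proof.
move=> cA e0; have [/existsP[i vi]|/existsPn nv] := boolP [exists i, v \in A i].
  rewrite (bigD1 i)//= vi mul1r big1 ?addr0// => j ji.
  rewrite [_ \in _](_ : _ = false) ?mul0r//; apply: contraNF ji => vj.
  exact/eqP/(chains_disj cA vj vi).
by rewrite big1// => i _; rewrite (negbTE (nv i)) mul0r.
Qed.

(** Labels that occur on one side only have gain 0, but they escape [compatible],
    which needs a witness on the other side. *)
Definition two_sided S S' (I : finType) (A : I -> {set S}) (B : I -> {set S'}) :=
  forall i, (A i == set0) = (B i == set0).

(** Labels on one side only can be erased, because their gain is 0. *)
Lemma coupling_two_sided S S' (I : finType) (A : I -> {set S}) (B : I -> {set S'}) :
  coupling A B -> exists (A' : I -> {set S}) (B' : I -> {set S'}),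
    [/\ coupling A' B', two_sided A' B' & total_gain A' B' = total_gain A B].
Proof.
move=> AB; exists (fun i => if B i == set0 then set0 else A i).
exists (fun i => if A i == set0 then set0 else B i); split.
- by apply: coupling_sub AB => i; case: ifP; rewrite ?sub0set.
- by move=> i; case: ifPn => [/eqP Bi|Bi]; case: ifPn => [/eqP Ai|Ai];
    rewrite ?eqxx ?Ai ?Bi ?eqxx ?(negbTE Ai) ?(negbTE Bi).
- apply: eq_bigr => i _; case: ifPn => [/eqP Bi|Bi]; case: ifPn => [/eqP Ai|Ai];
    by rewrite ?Ai ?Bi ?mass0 ?gain0l ?gain0r.
Qed.

Lemma two_sided_ex S S' (I : finType) (A : I -> {set S}) (B : I -> {set S'}) i u :
  two_sided A B -> u \in A i -> exists w, w \in B i.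
Proof.
move=> l ui; apply/set0Pn; rewrite -l; apply/set0Pn; by exists u.
Qed.

Lemma two_sided_sym S S' (I : finType) (A : I -> {set S}) (B : I -> {set S'}) :
  two_sided A B -> two_sided B A.
Proof. by move=> l i; rewrite l. Qed.

(** Each edit gives such a map, from the tree with fewer vertices if their numbers
    differ. It transports all conditions on a coupling, which do not see weights. *)
Record embedding S S' (f : S' -> S) : Prop := Embedding {
  embedding_inj : injective f ;
  embedding_root : f (root S') = root S ;
  embedding_vle : forall u v, vle (f u) (f v) = vle u v
}.

Lemma coupling_imset S S' S3 (f : S' -> S) (I : finType) (A : I -> {set S'})
    (B : I -> {set S3}) :
  embedding f -> coupling A B -> coupling (fun i => f @: A i) B.
Proof.
move=> [fI fr fv] [cA cB AB]; split=> //; last first.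
  by move=> i j _ _ w w' ij /imsetP[u ui ->] /imsetP[u' uj ->]; rewrite fv; exact: AB.
split=> [i|i j _ /imsetP[u ui ->]|i _ _ /imsetP[u ui ->] /imsetP[v vi ->]].
- rewrite -fr mem_imset//; exact: chains_root.
- rewrite mem_imset//; exact: (chains_disj cA).
- rewrite !fv; exact: (chains_cmp cA ui vi).
Qed.

Lemma coupling_preim S S' S3 (f : S' -> S) (I : finType) (A : I -> {set S})
    (B : I -> {set S3}) :
  embedding f -> coupling A B -> coupling (fun i => f @^-1: A i) B.
Proof.
move=> [fI fr fv] [cA cB AB]; split=> //; last first.
  by move=> i j u u' w w' ij; rewrite !inE -fv; exact: AB.
split=> [i|i j u|i u v]; rewrite !inE ?fr -?fv.
- exact: chains_root.
- exact: (chains_disj cA).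
- exact: (chains_cmp cA).
Qed.

(** Twins cannot be told apart by the conditions on a coupling. The case in view is
    a vertex of degree 2 and its child. *)
Definition twins S (z v : S) := forall s, s != z -> s != v ->
  vle s z = vle s v /\ vle z s = vle v s.

Lemma twins_sym S (z v : S) : twins z v -> twins v z.
Proof. by move=> t s sv sz; have [-> ->] := t s sz sv. Qed.

Lemma coupling_twin S S' (I : finType) (A : I -> {set S}) (B : I -> {set S'})
    (z v : S) :
  twins z v -> vle z v || vle v z -> v != root S -> (forall i, v \notin A i) ->
  coupling A B -> coupling (fun i => if z \in A i then v |: A i else A i) B.
Proof.
move=> tw zv vr vA [cA cB AB].
pose A' i := if z \in A i then v |: A i else A i.
have A'P i u : u \in A' i -> u \in A i \/ u = v /\ z \in A i.
  rewrite /A'; case: ifP => zi; last by left.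
  by rewrite in_setU1 => /orP[/eqP->|]; [right|left].
have nz i j : i != j -> z \in A j -> forall u, u \in A i -> (u != z) * (u != v).
  move=> ij zj u ui; split; apply: contraNneq ij => uE.
    by rewrite (chains_disj cA ui (j := j)) ?uE.
  by rewrite uE (negbTE (vA i)) in ui.
split=> //.
- split=> [i|i j u /A'P ui /A'P uj|i u u' /A'P ui /A'P ui'].
  + apply/negP => /A'P[|[/eqP]]; first by rewrite (negbTE (chains_root cA i)).
    by rewrite eq_sym (negbTE vr).
  + case: ui uj => [ui|[uE zi]] [uj|[uE' zj]].
    * exact: (chains_disj cA ui uj).
    * by rewrite uE' (negbTE (vA i)) in ui.
    * by rewrite uE (negbTE (vA j)) in uj.
    * exact: (chains_disj cA zi zj).
  + case: ui ui' => [ui|[uE zi]] [ui'|[uE' zi']].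
    * exact: (chains_cmp cA ui ui').
    * have [->|uz] := eqVneq u z; first by rewrite uE'.
      have uv : u != v by apply: contraTneq ui => ->.
      rewrite uE'; have [<- <-] := tw _ uz uv; exact: (chains_cmp cA ui zi').
    * have [->|uz] := eqVneq u' z; first by rewrite uE orbC.
      have uv : u' != v by apply: contraTneq ui' => ->.
      rewrite uE; have [<- <-] := tw _ uz uv; exact: (chains_cmp cA zi ui').
    * by rewrite uE uE' vle_refl.
- move=> i j u u' w w' ij /A'P ui /A'P uj wi wj.
  case: ui uj => [ui|[uE zi]] [uj|[uE' zj]].
  + exact: (AB i j).
  + have [uz uv] := nz _ _ ij zj _ ui; rewrite uE'.
    by have [<- _] := tw _ uz uv; exact: (AB i j).
  + have ji : j != i by rewrite eq_sym.
    have [uz uv] := nz _ _ ji zi _ uj; rewrite uE.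
    by have [_ <-] := tw _ uz uv; exact: (AB i j).
  + by case/eqP: ij; exact: (chains_disj cA zi zj).
Qed.

Lemma total_gain_mono S S' S1 S1' (I : finType) (A : I -> {set S})
    (B : I -> {set S'}) (A1 : I -> {set S1}) (B1 : I -> {set S1'}) :
  (forall i, gain (mass (A i)) (mass (B i)) <= gain (mass (A1 i)) (mass (B1 i))) ->
  total_gain A B <= total_gain A1 B1.
Proof. by move=> h; apply: ler_sum. Qed.

(** If the labels [i] and [j] contain twins, no third label lies between their
    chains, in either tree, so that their unions satisfy the conditions again. *)
Lemma coupling_merge S S' (I : finType) (A : I -> {set S}) (B : I -> {set S'})
    (z v : S) i j :
  twins z v -> vle z v || vle v z -> i != j -> z \in A i -> v \in A j ->
  coupling A B -> two_sided A B ->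
  let merge T (C : I -> {set T}) k :=
    if k == i then C i :|: C j else if k == j then set0 else C k in
  coupling (merge S A) (merge S' B) /\
  total_gain A B <= total_gain (merge S A) (merge S' B).
Proof.
move=> tw zv ij zi vj [cA cB AB] l merge.
have ji : j != i by rewrite eq_sym.
have mP (T : finType) (C : I -> {set T}) k u :
    u \in merge T C k -> exists2 k0, u \in C k0 & (if k0 == j then i else k0) = k.
  rewrite /merge; case: eqP => [->|/eqP ki].
    case/setUP => uC; first by exists i; rewrite // (negbTE ij).
    by exists j; rewrite // eqxx.
  case: eqP => [_|/eqP kj]; first by rewrite inE.
  by move=> uC; exists k; rewrite // (negbTE kj).
have [wi wiB] := two_sided_ex l zi; have [wj wjB] := two_sided_ex l vj.
(* A third label compares in the same way with the two labels: pass from one to the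
   other through the twins. *)
have key p q y t : twins y t -> y \in A p -> t \in A q -> p != q ->
    forall k u u' w w', k != p -> k != q -> u \in A p -> w \in B q ->
    u' \in A k -> w' \in B k -> vle u u' = vle w w' /\ vle u' u = vle w' w.
  move=> ytw yp tq pq k u u' w w' kp kq up wq u'k w'k.
  have [w1 w1p] := two_sided_ex l yp.
  have u'y : u' != y.
    by apply: contraNneq kp => uE; rewrite (chains_disj cA u'k (j := p)) ?uE.
  have u't : u' != t.
    by apply: contraNneq kq => uE; rewrite (chains_disj cA u'k (j := q)) ?uE.
  have [e1 e2] := ytw _ u'y u't.
  have pk : p != k by rewrite eq_sym.
  have qk : q != k by rewrite eq_sym.
  split.
  - rewrite (AB _ _ _ _ _ _ pk up u'k w1p w'k) -(AB _ _ _ _ _ _ pk yp u'k w1p w'k).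
    by rewrite e2; exact: (AB q k).
  - rewrite (AB _ _ _ _ _ _ kp u'k up w'k w1p) -(AB _ _ _ _ _ _ kp u'k yp w'k w1p).
    by rewrite e1; exact: (AB k q).
have mchains (T T' : dendrogram X) (C : I -> {set T}) (D : I -> {set T'}) t t' :
    chains C -> compatible C D -> two_sided C D ->
    t \in D i -> t' \in D j -> vle t t' || vle t' t -> chains (merge T C).
  move=> cC CD lC ti t'j tt'; split.
  - by move=> k; apply/negP => /mP[k0]; rewrite (negbTE (chains_root cC k0)).
  - move=> k k' u /mP[k0 u0 <-] /mP[k1 u1 <-].
    by rewrite (chains_disj cC u0 u1).
  - move=> k u u' /mP[k0 u0 <-] /mP[k1 u1 ke].
    have [k01|k01] := eqVneq k0 k1.
      by rewrite -k01 in u1; exact: (chains_cmp cC u0 u1).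
    move: ke; case: eqP => [k1E|_]; case: eqP => [k0E|_] => kE.
    + by rewrite k0E k1E eqxx in k01.
    + rewrite k1E -kE in u1 u0 *.
      by rewrite (CD _ _ _ _ _ _ ij u0 u1 ti t'j) (CD _ _ _ _ _ _ ji u1 u0 t'j ti).
    + rewrite k0E kE in u1 u0 *.
      rewrite (CD _ _ _ _ _ _ ji u0 u1 t'j ti) (CD _ _ _ _ _ _ ij u1 u0 ti t'j).
      by rewrite orbC.
    + by rewrite kE eqxx in k01.
have BA : compatible B A by move=> k k' ? ? ? ? ? ? ? ? ?; exact/esym/(AB k k').
split.
- split.
  + apply: (mchains _ _ _ _ wi wj cA AB l wiB wjB).
    by rewrite -(AB _ _ _ _ _ _ ij zi vj wiB wjB) -(AB _ _ _ _ _ _ ji vj zi wjB wiB).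
  + exact: (mchains _ _ _ _ z v cB BA (two_sided_sym l) zi vj zv).
  + move=> k k' u u' w w' kk' /mP[a ua ak] /mP[b ub bk] /mP[c wc ck] /mP[d wd dk].
    (* Two different labels are sent to the same one only if they are i and j. *)
    have split_lab p q m : p != q -> (if p == j then i else p) = m ->
        (if q == j then i else q) = m ->
        m = i /\ (p = i /\ q = j \/ p = j /\ q = i).
      move=> pq; case: (eqVneq p j) => [pE|pj]; case: (eqVneq q j) => [qE|qj].
      - by rewrite pE qE eqxx in pq.
      - by move=> <- ->; split=> //; right.
      - by move=> <- ->; split=> //; left.
      - by move=> pE qE; rewrite pE qE eqxx in pq.
    have away p m : m != i -> (if p == j then i else p) = m -> p != i /\ p != j.
      case: (eqVneq p j) => [_|pj] + pm; first by rewrite pm eqxx.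
      by rewrite pm.
    have ztw := twins_sym tw.
    have [E1|N1] := eqVneq a c; have [E2|N2] := eqVneq b d.
    * rewrite -E1 -E2 in wc wd; apply: (AB a b) => //.
      by apply: contraNneq kk' => ab; rewrite -ak -bk ab.
    * rewrite -E1 in wc; have [k'i bd] := split_lab _ _ _ N2 bk dk.
      rewrite k'i in kk'; have [ai aj] := away _ _ kk' ak.
      case: bd => [[bE dE]|[bE dE]]; rewrite bE in ub; rewrite dE in wd.
      -- by have [_ ->] := key _ _ _ _ tw zi vj ij _ _ _ _ _ ai aj ub wd ua wc.
      -- by have [_ ->] := key _ _ _ _ ztw vj zi ji _ _ _ _ _ aj ai ub wd ua wc.
    * rewrite -E2 in wd; have [ki ac] := split_lab _ _ _ N1 ak ck.
      rewrite ki eq_sym in kk'; have [bi bj] := away _ _ kk' bk.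
      case: ac => [[aE cE]|[aE cE]]; rewrite aE in ua; rewrite cE in wc.
      -- by have [-> _] := key _ _ _ _ tw zi vj ij _ _ _ _ _ bi bj ua wc ub wd.
      -- by have [-> _] := key _ _ _ _ ztw vj zi ji _ _ _ _ _ bj bi ua wc ub wd.
    * have [ki _] := split_lab _ _ _ N1 ak ck.
      have [k'i _] := split_lab _ _ _ N2 bk dk.
      by rewrite ki k'i eqxx in kk'.
- have mU (T : dendrogram X) (C : I -> {set T}) : chains C ->
      mass (C i :|: C j) = mass (C i) (.) mass (C j).
    move=> cC; rewrite /mass -bigU/=; last first.
      rewrite disjoint_subset; apply/fintype.subsetP => u ui; rewrite inE.
      by apply: contraNN ij => uj; exact/eqP/(chains_disj cC ui uj).
    by apply: eq_bigl => u; rewrite !inE.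
  rewrite /total_gain (bigD1 i)//= (bigD1 j)//= [leRHS](bigD1 i)//=.
  rewrite (bigD1 (P := fun k => k != i) j)//= /merge !eqxx (negbTE ji) !mass0 gain0l add0r.
  rewrite addrA lerD//; first by rewrite !mU// gain_op.
  by rewrite le_eqVlt; apply/orP; left; apply/eqP/eq_bigr => k /andP[/negbTE-> /negbTE->].
Qed.

End Couplings.

(** * Edits act on couplings *)

Section EditsToCouplings.
Context {R : realType} {X : editableSpace R}.
Implicit Types S : dendrogram X.

Local Notation "0_X" := (ezero X).
Local Notation "x (.) y" := (eop X x y) (at level 40, left associativity).

Lemma iso_embedding S S' (f : S' -> S) : tree_iso f -> embedding f.
Proof.
move=> [/bij_inj fI fr fp].
have fit n u : f (iter n parent u) = iter n parent (f u).
  by elim: n => //= n IHn; rewrite fp IHn.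
split=> // u v; apply/vleP/vleP => -[n nv]; exists n.
  by apply: fI; rewrite fit.
by rewrite -fit nv.
Qed.

Lemma removal_embedding S S' (v : S) (f : S' -> S) :
  v != root S -> tree_removal v f -> embedding f.
Proof.
move=> vr [fI fim fr fp].
have fv u : f u != v by apply/fim; exists u.
split=> // u w; apply/vleP/idP => [[n]|/vleP[n <-]].
(* One step in S' is two steps in S if it jumps over v, hence the strong induction on
   the number of steps in S. *)
- have [m] := ubnP n; elim: m n u => // m IHm [|n] u; rewrite ltnS => nm.
    by move=> /= /fI->; exact: vle_refl.
  rewrite iterSr; have := fp u; case: ifP => [/eqP uv|_] fpu; last first.
    by rewrite -fpu => /(IHm _ _ nm); apply: vle_trans; exact: vle_parent.
  rewrite uv; case: n nm => [_ /= e|n nm]; first by have := fv w; rewrite -e eqxx.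
  rewrite iterSr -fpu => e; apply: vle_trans (vle_parent u) _.
  by apply: (IHm n) => //; exact: ltnW.
- elim: n u => [|n IHn] u; first by exists 0%N.
  rewrite iterSr; have [k <-] := IHn (parent u).
  rewrite fp; case: ifP => [/eqP <-|_].
    by exists k.+2; rewrite !iterSr.
  by exists k.+1; rewrite iterSr.
Qed.

Lemma sum_removal S S' (v : S) (f : S' -> S) (F : S -> R) :
  tree_removal v f -> \sum_s F s = F v + \sum_u F (f u).
Proof.
move=> [fI fim _ _]; rewrite (bigD1 v)//=; congr +%R.
transitivity (\sum_(s in f @: [set: S']) F s).
  apply: eq_bigl => s; apply/idP/imsetP => [/fim[u <-]|[u _ ->]]; first by exists u.
  by apply/fim; exists u.
rewrite big_imset/=; last by move=> x y _ _; exact: fI.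
by apply: eq_bigl => u; rewrite inE.
Qed.

Lemma child_above S (s v : S) :
  vle s v -> s != v -> exists2 t, child t v & vle s t.
Proof.
move=> /vleP[n]; elim: n s => [|n IHn] s; first by move=> /= ->; rewrite eqxx.
rewrite iterSr => e sv; have [pv|pv] := eqVneq (parent s) v.
  exists s; last exact: vle_refl.
  rewrite /child pv eqxx andbT; apply: contraNneq sv => sr.
  by rewrite -pv sr parent_root.
have [t tv st] := IHn _ e pv; exists t => //.
exact: vle_trans (vle_parent s) st.
Qed.

(** No branch leaves the tree between the two vertices. *)
Lemma degree2_twins S (v : S) : degree2 v ->
  exists z, [/\ z != v, twins z v, vle z v & forall s, child s v = (s == z)].
Proof.
move=> /andP[vr /cards1P[z zE]].
have cz s : child s v = (s == z) by have := in_set1 s z; rewrite -zE inE.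
have zc : child z v by rewrite cz.
case/andP: (zc) => zr /eqP pz.
have zv : z != v by rewrite -pz eq_sym parent_neq.
exists z; split=> //; last by rewrite -pz vle_parent.
move=> s sz sv; split; last by rewrite vle_neq_parent ?pz// eq_sym.
apply/idP/idP => [sz'|sv']; first by rewrite (vle_trans sz')// -pz vle_parent.
have [t] := child_above sv' sv.
by rewrite cz => /eqP ->.
Qed.

Lemma dnorm_iso S S' (f : S' -> S) (F : S -> R) :
  tree_iso f -> \sum_u F (f u) = \sum_s F s.
Proof. by move=> [fb _ _]; rewrite [RHS](reindex f)//; exact: onW_bij. Qed.

Section Steps.
Variables S1 S2 S3 : dendrogram X.
Variable M : matching S2 S3.

(** After subtraction of both sides from total norms this says that the cost
    [dnorm S1 + dnorm S3 - mgain M1] attached to [M1] exceeds the one attached to [M]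
    by [c] at most. *)
Definition transfers (c : R) := exists M1 : matching S1 S3,
  mgain M + dnorm S1 <= mgain M1 + dnorm S2 + c.

Lemma transfers_isomorphic : isomorphic S1 S2 -> transfers 0.
Proof.
move=> [f fi fw]; have fe := iso_embedding fi.
rewrite /transfers; case: M => I A B AB; have fAB := coupling_imset fe AB.
exists (Matching fAB).
rewrite addr0 /mgain/= lerD//.
  apply: total_gain_mono => i; rewrite (mass_imset _ (embedding_inj fe)).
  by rewrite /mass (eq_bigr (fun u => wt (f u))).
rewrite !dnormE -(dnorm_iso (fun s => enorm (wt s)) fi) le_eqVlt; apply/orP; left.
by apply/eqP/eq_bigr => u _; rewrite fw.
Qed.

Lemma transfers_shrink (v : S1) b : shrinks v b S2 -> transfers (mdist (wt v) b).
Proof.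
move=> [vr [f fi fw]]; have fe := iso_embedding fi.
have fI := embedding_inj fe.
rewrite /transfers; case: M => I A B AB; have fAB := coupling_imset fe AB.
exists (Matching fAB).
rewrite /mgain/=; have [g fK gK] : bijective f by case: fi.
have fE : f (g v) = v by rewrite gK.
have dE1 : dnorm S1 = \sum_(u | u != g v) enorm (wt (f u)) + enorm (wt v).
  rewrite dnormE -(dnorm_iso (fun s => enorm (wt s)) fi) (bigD1 (g v))//= fE.
  by rewrite addrC.
have dE2 : dnorm S2 = \sum_(u | u != g v) enorm (wt (f u)) + enorm b.
  rewrite dnormE (bigD1 (g v))//= fw fE eqxx addrC; congr +%R.
  by apply: eq_bigr => u; rewrite fw -(inj_eq fI) fE => /negbTE ->.
set e := enorm b - enorm (wt v) + mdist (wt v) b.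
have e0 : 0 <= e.
  rewrite /e; have := metric_triangle (wt v) b 0_X.
  rewrite -/(enorm b) -/(enorm (wt v)); lra.
suff le_gain : total_gain A B <= total_gain (fun i => f @: A i) B + e.
  by rewrite dE1 dE2; move: le_gain; rewrite /e; lra.
have [cA _ _] := AB.
apply: le_trans (_ : _ <= \sum_i (gain (mass (f @: A i)) (mass (B i))
   + (g v \in A i)%:R * e)) _; last first.
  by rewrite big_split/= lerD2l; exact: chains_sum_le cA e0.
apply: ler_sum => i _; rewrite mass_imset//.
have [vi|vi] := boolP (g v \in A i).
  have mE : \big[eop X/0_X]_(u in A i :\ g v) wt (f u) = mass (A i :\ g v).
    apply: eq_bigr => u.
    by rewrite !inE fw -(inj_eq fI) fE => /andP[/negbTE-> _].
  rewrite (massD1 vi) (big_setD1 (g v))//= mE fw fE eqxx mul1r.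
  rewrite [wt v (.) _]Monoid.mulmC; exact: gain_opl_lip.
rewrite mul0r addr0 /mass; rewrite le_eqVlt; apply/orP; left; apply/eqP.
congr gain; apply: eq_bigr => u ui; rewrite fw; case: eqP => // fu.
by rewrite -fu fK ui in vi.
Qed.

(** The deleted edge stays without label, and the sum of all norms changes by exactly
    the cost of the edit. *)
Lemma transfers_delete (v : S1) : deletes v S2 -> transfers (mdist (wt v) 0_X).
Proof.
move=> [vr [f fr fw]]; have fe := removal_embedding vr fr.
rewrite /transfers; case: M => I A B AB; exists (Matching (coupling_imset fe AB)).
rewrite -/(enorm _) /mgain/= -addrA lerD//.
  apply: total_gain_mono => i; rewrite (mass_imset _ (embedding_inj fe)).
  by rewrite /mass (eq_bigr (fun u => wt (f u))).
rewrite !dnormE (sum_removal _ fr) addrC lerD2l.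
by rewrite le_eqVlt; apply/orP; left; apply/eqP/eq_bigr => u _; rewrite fw.
Qed.

(** The inserted edge may belong to a chain, from which it has to be removed. *)
Lemma transfers_insert (v : S2) : deletes v S1 -> transfers (mdist (wt v) 0_X).
Proof.
move=> [vr [f fr fw]]; have fe := removal_embedding vr fr.
have fI := embedding_inj fe; have [_ fim _ _] := fr.
rewrite /transfers; case: M => I A B AB; exists (Matching (coupling_preim fe AB)).
rewrite -/(enorm _) /mgain/=.
have -> : dnorm S2 = enorm (wt v) + dnorm S1.
  rewrite !dnormE (sum_removal _ fr); congr +%R.
  by apply: eq_bigr => u _; rewrite fw.
set e := 2 * enorm (wt v).
have e0 : 0 <= e by rewrite mulr_ge0// enorm_ge0.
suff : total_gain A B <= total_gain (fun i => f @^-1: A i) B + e.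
  by rewrite /e; lra.
have [cA _ _] := AB.
apply: le_trans (_ : _ <= \sum_i (gain (mass (f @^-1: A i)) (mass (B i))
   + (v \in A i)%:R * e)) _; last first.
  by rewrite big_split/= lerD2l; exact: chains_sum_le cA e0.
apply: ler_sum => i _.
have -> : mass (f @^-1: A i) = mass (A i :\ v).
  have -> : mass (f @^-1: A i) = mass (f @: (f @^-1: A i)).
    by rewrite mass_imset//; apply: eq_bigr => u _; rewrite fw.
  congr mass; apply/setP => s; rewrite !inE; apply/imsetP/andP.
    by move=> [u + ->]; rewrite inE => ui; split=> //; apply/fim; exists u.
  by move=> [/fim[u <-] ui]; exists u; rewrite ?inE.
have [vi|vi] := boolP (v \in A i); first by rewrite (massD1 vi) mul1r gain_opl_le.
by rewrite mul0r addr0 (setDidPl _)// disjoint_sym disjoints1.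
Qed.

Lemma dnorm_ghost S S' (v : S) : ghosts v S' -> dnorm S' = dnorm S.
Proof.
move=> [v2 [f fr fw]]; have [z [zv _ _ cz]] := degree2_twins v2.
have [fI fim _ _] := fr; have [u0 u0z] : exists u, f u = z by apply/fim.
rewrite !dnormE (sum_removal _ fr) (bigD1 u0)//= [in RHS](bigD1 u0)//=.
rewrite fw cz u0z eqxx enorm_op addrA [enorm (wt z) + _]addrC; congr +%R.
by apply: eq_bigr => u; rewrite fw cz -u0z (inj_eq fI) => /negbTE ->.
Qed.

(** The weight of the joined edge is the product of the two weights. A set with only
    one of the two edges would lose a factor. *)
Lemma mass_ghost S S' (v : S) (f : S' -> S) z (A : {set S}) :
  tree_removal v f -> (forall s, child s v = (s == z)) -> z != v ->
  (forall u, wt u = if child (f u) v then wt (f u) (.) wt v else wt (f u)) ->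
  (v \in A) = (z \in A) -> mass (f @^-1: A) = mass A.
Proof.
move=> [fI fim _ _] cz zv fw vz; have [u0 u0z] : exists u, f u = z by apply/fim.
have imE : f @: (f @^-1: A) = A :\ v.
  apply/setP => s; rewrite !inE; apply/imsetP/andP.
    by move=> [u + ->]; rewrite inE => ui; split=> //; apply/fim; exists u.
  by move=> [/fim[u <-] ui]; exists u; rewrite ?inE.
have [zA|zA] := boolP (z \in A); last first.
  have vA : v \notin A by rewrite vz.
  have AE : f @: (f @^-1: A) = A.
    by rewrite imE (setDidPl _)// disjoint_sym disjoints1.
  transitivity (mass (f @: (f @^-1: A))); last by rewrite AE.
  rewrite mass_imset//.
  apply: eq_bigr => u; rewrite inE fw cz => uA; case: eqP => // uz.
  by rewrite uz (negbTE zA) in uA.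
have vA : v \in A by rewrite vz.
rewrite (massD1 vA) -imE mass_imset// /mass (big_setD1 u0) ?inE ?u0z//=.
rewrite [in RHS](big_setD1 u0) ?inE ?u0z//= fw cz u0z eqxx.
rewrite [LHS]Monoid.mulmAC (eq_bigr (fun u => wt (f u)))// => u.
by rewrite !inE fw cz -u0z (inj_eq fI) => /andP[/negbTE -> _].
Qed.

(** The label of the joined edge is given to both of the edges it comes from. *)
Lemma transfers_ghost (v : S1) : ghosts v S2 -> transfers 0.
Proof.
move=> gv; have dE12 := dnorm_ghost gv; case: gv => v2 [f fr fw].
have vr : v != root S1 by case/andP: v2.
have fe := removal_embedding vr fr; have [fI fim _ _] := fr.
have [z [zv tw zle cz]] := degree2_twins v2.
have [u0 u0z] : exists u, f u = z by apply/fim.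
rewrite /transfers; case: M => I A B AB; have fAB := coupling_imset fe AB.
have vA i : v \notin f @: A i.
  by apply/imsetP => -[u _ vE]; have /eqP : v != v by apply/fim; exists u.
have zle' : vle z v || vle v z by rewrite zle.
exists (Matching (coupling_twin tw zle' vr vA fAB)); rewrite addr0 dE12 lerD2r.
apply: total_gain_mono => i; rewrite le_eqVlt; apply/orP; left; apply/eqP.
congr gain => /=; set A' := (if _ then _ else _).
have vzA' : (v \in A') = (z \in A').
  by rewrite /A'; case: ifPn => zi; rewrite ?in_setU1 ?eqxx ?zi ?orbT//
    (negbTE zi) (negbTE (vA i)).
rewrite -(mass_ghost fr cz zv fw vzA'); congr mass; apply/setP => u.
rewrite inE /A'; case: ifP => _; rewrite ?in_setU1 mem_imset//.
by rewrite (_ : f u == v = false)//; apply/negbTE/fim; exists u.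
Qed.

(** The two halves of the split edge must first be given the same label. If only one
    of them has a label the other receives it, and if their labels differ these are
    merged; the gain does not decrease. *)
Lemma transfers_split (v : S2) : ghosts v S1 -> transfers 0.
Proof.
move=> gv; have dE12 := dnorm_ghost gv; case: gv => v2 [f fr fw].
have vr : v != root S2 by case/andP: v2.
have fe := removal_embedding vr fr; have [fI fim _ _] := fr.
have [z [zv tw zle cz]] := degree2_twins v2.
have zle' : vle z v || vle v z by rewrite zle.
have zr : z != root S2 by have := cz z; rewrite eqxx => /andP[].
suff [I [A [B [AB vz gAB]]]] : exists (I : finType) (A : I -> {set S2}) (B : I -> {set S3}),
    [/\ coupling A B, forall i, (v \in A i) = (z \in A i) & mgain M <= total_gain A B].
  exists (Matching (coupling_preim fe AB)); rewrite addr0 dE12 lerD2r.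
  apply: le_trans gAB _; apply: total_gain_mono => i.
  by rewrite /= (mass_ghost fr cz zv fw (vz i)).
case: M => I A0 B0 AB0; rewrite /mgain/=.
have [A [B [AB twoAB <-]]] := coupling_two_sided AB0; exists I.
have add y t : twins y t -> vle y t || vle t y -> t != root S2 ->
    (forall i, t \notin A i) -> exists A' : I -> {set S2},
    [/\ coupling A' B, forall i, (t \in A' i) = (y \in A' i)
      & total_gain A B <= total_gain A' B].
  move=> ytw yt tr tA; exists (fun i => if y \in A i then t |: A i else A i); split.
  - exact: coupling_twin.
  - by move=> i; case: ifPn => yi; rewrite ?in_setU1 ?eqxx ?yi ?orbT//
      (negbTE yi) (negbTE (tA i)).
  - by apply: total_gain_mono => i; case: ifP => // _; rewrite massU1// gain_opl.
have [/existsP[i zi]|/existsPn zA] := boolP [exists i, z \in A i]; last first.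
  have [|A' [A'B vz gA']] := add v z (twins_sym tw) _ zr zA; first by rewrite orbC.
  by exists A', B; split=> // i; rewrite vz.
have [/existsP[j vj]|/existsPn vA] := boolP [exists j, v \in A j]; last first.
  by have [A' [A'B vz gA']] := add z v tw zle' vr vA; exists A', B.
have [cA _ _] := AB.
have [ij|ij] := eqVneq i j.
  exists A, B; split=> // k; rewrite -ij in vj.
  apply/idP/idP => [vk|zk]; first by rewrite -(chains_disj cA vj vk).
  by rewrite -(chains_disj cA zi zk).
have [mAB gAB] := coupling_merge tw zle' ij zi vj AB twoAB.
eexists; eexists; split; [exact: mAB| |exact: gAB].
move=> k /=; case: eqP => [_|/eqP ki]; first by rewrite !inE zi vj orbT.
case: eqP => [_|/eqP kj]; first by rewrite !inE.
by apply/idP/idP => [vk|zk]; [rewrite (chains_disj cA vk vj) eqxx in kj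
  |rewrite (chains_disj cA zk zi) eqxx in ki].
Qed.

End Steps.

(** The inequality behind the lower bound: the cost of couplings satisfies the
    triangle inequality with respect to single edits. *)
Lemma edit_transfers S1 S2 S3 (M : matching S2 S3) c :
  edit S1 S2 c -> transfers S1 M c.
Proof.
move=> e; case: e M => {S1 S2} [S S' v b|S S' v|S S' v|S S' v|S S' v] h M.
- exact: transfers_shrink.
- exact: transfers_delete.
- exact: transfers_insert.
- exact: transfers_ghost h.
- exact: transfers_split h.
Qed.

(** Each edge is its own label; the root, which carries no edge, is a label without
    members. *)
Lemma identity_coupling S : coupling
  (fun i : S => if i == root S then set0 else [set i])
  (fun i : S => if i == root S then set0 else [set i]).
Proof.
have memE (i u : S) :
    (u \in if i == root S then set0 else [set i]) = (i != root S) && (u == i).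
  by case: eqVneq => _; rewrite inE.
have cS : chains (fun i : S => if i == root S then set0 else [set i]).
  split=> [i|i j u|i u v]; rewrite !memE.
  - by rewrite negb_and negbK eq_sym orbN.
  - by move=> /andP[_ /eqP ->] /andP[_ /eqP].
  - by move=> /andP[_ /eqP ->] /andP[_ /eqP ->]; rewrite vle_refl.
split=> // i j u u' w w' _; rewrite !memE.
by move=> /andP[_ /eqP ->] /andP[_ /eqP ->] /andP[_ /eqP ->] /andP[_ /eqP ->].
Qed.

Lemma identity_gain S : mgain (Matching (identity_coupling S)) = 2 * dnorm S.
Proof.
rewrite /mgain /total_gain/= dnormE mulr_sumr; apply: eq_bigr => i _.
rewrite /gain mdistxx; case: eqVneq => [->|_].
  have -> : wt (root S) = 0_X by apply/eqP; rewrite wt_eq0.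
  by rewrite mass0 enorm0; lra.
by rewrite /mass big_set1; lra.
Qed.

Lemma matching_of_path S S' c : edit_path S S' c ->
  exists M : matching S S', dnorm S + dnorm S' - mgain M <= c.
Proof.
elim=> {S S' c} [S S' /transfers_isomorphic|S1 S2 S3 c c' e _ [M MP]].
  move=> /(_ _ (Matching (identity_coupling S')))[M]; rewrite identity_gain => MP.
  by exists M; lra.
by have [M1 M1P] := edit_transfers M e; exists M1; lra.
Qed.

End EditsToCouplings.

(** * Constructions of edits and edit paths *)

Section Realisation.
Context {R : realType} {X : editableSpace R}.
Implicit Types S : dendrogram X.

Local Notation "0_X" := (ezero X).
Local Notation "x (.) y" := (eop X x y) (at level 40, left associativity).

Lemma tree_iso_sym S S' (f : S' -> S) : tree_iso f ->
  exists g : S -> S', [/\ tree_iso g, cancel f g & cancel g f].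
Proof.
move=> [[g fK gK] fr fp]; exists g; split=> //; split; first by exists f.
  by rewrite -fr fK.
by move=> s; apply: (can_inj fK); rewrite fp !gK.
Qed.

Lemma tree_iso_id S : tree_iso (@id S).
Proof. by split=> //; exists id. Qed.

Lemma isomorphic_refl S : isomorphic S S.
Proof. by exists id => //; exact: tree_iso_id. Qed.

Lemma isomorphic_sym S S' : isomorphic S S' -> isomorphic S' S.
Proof.
move=> [f /tree_iso_sym[g [gi fK gK]] fw]; exists g => // s.
by rewrite fw gK.
Qed.

Lemma removal_iso_l S S1 S2 (f : S1 -> S) (g : S2 -> S1) v :
  tree_iso f -> tree_removal v g -> tree_removal (f v) (f \o g).
Proof.
move=> fi; have [h [_ fK hK]] := tree_iso_sym fi.
have fI := can_inj fK; case: fi => _ fr fp [gI gim gr gp]; split.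
- exact: inj_comp.
- move=> s; rewrite -(hK s) (inj_eq fI); split=> [/gim[u <-]|[u /fI gu]].
    by exists u.
  by apply/gim; exists u.
- by rewrite /= gr fr.
- by move=> u /=; rewrite gp -!fp (inj_eq fI); case: ifP.
Qed.

Lemma removal_iso_r S S1 S2 (h : S -> S1) (g : S1 -> S2) v :
  tree_iso h -> tree_removal v g -> tree_removal v (g \o h).
Proof.
move=> hi; have [k [_ hK kK]] := tree_iso_sym hi.
case: hi => _ hr hp [gI gim gr gp]; split.
- by apply: inj_comp => //; exact: can_inj hK.
- move=> s; split=> [/gim[u <-]|[u us]]; first by exists (k u); rewrite /= kK.
  by apply/gim; exists (h u).
- by rewrite /= hr gr.
- by move=> u /=; rewrite hp gp.
Qed.

Lemma child_iso S S' (f : S' -> S) u v : tree_iso f -> child (f u) (f v) = child u v.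
Proof.
move=> [/bij_inj fI fr fp]; rewrite /child -fp (inj_eq fI); congr (_ && _).
by rewrite -fr (inj_eq fI).
Qed.

Lemma degree2_iso S S' (f : S' -> S) v : tree_iso f -> degree2 (f v) = degree2 v.
Proof.
move=> fi; have [/bij_inj fI fr _] := fi.
rewrite /degree2 -fr (inj_eq fI); congr (_ && (_ == _)).
rewrite -(card_imset _ fI); apply: eq_card => s.
have [g [_ _ gK]] := tree_iso_sym fi.
by rewrite -(gK s) mem_imset// !inE child_iso.
Qed.

Lemma edit_iso S S1 S2 c : isomorphic S S1 -> edit S1 S2 c -> edit S S2 c.
Proof.
move=> iS e; have [h hi hw] := isomorphic_sym iS; case: iS => f fi fw.
have [/bij_inj fI fr _] := fi.
have root_f (v : S1) : v != root S1 -> f v != root S by rewrite -fr (inj_eq fI).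
case: e f fi fw h hi hw fI fr root_f => {S1 S2 c}
  [S1 S2 v b|S1 S2 v|S1 S2 v|S1 S2 v|S1 S2 v] E f fi fw h hi hw fI fr root_f.
- rewrite fw; case: E => vr [g gi gw]; apply: Shrink; split; first exact: root_f.
  exists (f \o g) => [|u /=]; last by rewrite (inj_eq fI) -fw.
  case: fi gi => fb _ fp [gb gr gp].
  by split; [exact: bij_comp|rewrite /= gr|move=> u; rewrite /= gp fp].
- rewrite fw; case: E => vr [g gi gw]; apply: Delete; split; first exact: root_f.
  exists (f \o g) => [|u /=]; last by rewrite -fw.
  exact: removal_iso_l.
- case: E => vr [g gi gw]; apply: Insert; split=> //.
  exists (g \o h) => [|u /=]; last by rewrite -gw.
  exact: removal_iso_r.
- case: E => v2 [g gi gw]; apply: (Ghost (v := f v)); split; first by rewrite degree2_iso.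
  exists (f \o g) => [|u /=]; last by rewrite child_iso// -!fw.
  exact: removal_iso_l.
- case: E => v2 [g gi gw]; apply: (Split (v := v)); split=> //.
  exists (g \o h) => [|u /=]; last by rewrite hw gw.
  exact: removal_iso_r.
Qed.

Lemma edit_sym S S' c : edit S S' c -> edit S' S c.
Proof.
case=> {S S' c} S S' v.
- move=> b [vr [f fi fw]]; have [g [gi fK gK]] := tree_iso_sym fi.
  have -> : mdist (wt v) b = mdist (wt (g v)) (wt v).
    by rewrite fw gK eqxx metric_sym.
  apply: Shrink; case: gi => gb gr gp; split.
    by rewrite -gr (inj_eq (can_inj gK)).
  exists g => // u; rewrite (inj_eq (can_inj gK)); case: eqP => [-> //|/eqP uv].
  by rewrite fw gK (negbTE uv).
- by move=> h; exact: Insert.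
- by move=> h; exact: Delete.
- by move=> h; exact: Split h.
- by move=> h; exact: Ghost h.
Qed.

(** Isomorphisms occur only at the end of a path; they are absorbed by the edit that
    follows ([edit_iso]). *)
Lemma edit_path_rcons S1 S2 S3 c c' :
  edit_path S1 S2 c -> edit S2 S3 c' -> edit_path S1 S3 (c + c').
Proof.
move=> p; elim: p S3 c' => {S1 S2 c} [S1 S2 iS|S1 S2 S3 c d e _ IHp] S4 c' e'.
  rewrite add0r -[c']addr0; apply: EditCons (EditNil (isomorphic_refl S4)).
  exact: edit_iso iS e'.
by rewrite -addrA; apply: EditCons e _; exact: IHp.
Qed.

Lemma edit_ge0 S S' c : edit S S' c -> 0 <= c.
Proof. by case=> *; rewrite ?mdist_ge0. Qed.

Lemma edit_path_ge0 S S' c : edit_path S S' c -> 0 <= c.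
Proof.
by elim=> // S1 S2 S3 d d' /edit_ge0 d0 _ d0'; rewrite addr_ge0.
Qed.

Section Removal.
Variables (S : dendrogram X) (v : S).
Hypothesis vr : v != root S.

Definition removal_vert : finType := {u : S | u != v}.

Lemma removal_root_subproof : root S != v.
Proof. by rewrite eq_sym. Qed.

Definition removal_root : removal_vert :=
  exist (fun u : S => u != v) _ removal_root_subproof.

Lemma removal_parent_subproof (u : S) :
  (if parent u == v then parent v else parent u) != v.
Proof. by case: ifPn => // _; exact: parent_neq. Qed.

Definition removal_parent (u : removal_vert) : removal_vert :=
  exist (fun u : S => u != v) _ (removal_parent_subproof (val u)).

Lemma removal_parent_root : removal_parent removal_root = removal_root.
Proof. by apply: val_inj; rewrite /= parent_root eq_sym (negbTE vr). Qed.

Lemma removal_to_root u : fconnect removal_parent u removal_root.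
Proof.
have [n] : exists n, iter n parent (val u) = root S by apply/vleP/vle_root.
have [m] := ubnP n; elim: m n u => // m IHm [|n] u; rewrite ltnS => nm.
  by move=> /= ur; rewrite (_ : u = removal_root) ?connect0//; exact: val_inj.
rewrite iterSr => ur; apply: connect_trans (fconnect1 _ _) _.
have [pv|pv] := eqVneq (parent (val u)) v; last first.
  by apply: (IHm n) => //; rewrite /= (negbTE pv).
rewrite pv in ur; case: n nm ur => [_ /= vE|n nm]; first by case/eqP: (vr).
rewrite iterSr => ur; apply: (IHm n); first exact: ltnW.
by rewrite /= pv eqxx.
Qed.

Definition removal (w : removal_vert -> X)
    (w0 : forall u, (w u == 0_X) = (u == removal_root)) : dendrogram X :=
  Dendrogram removal_parent_root removal_to_root w0.

Lemma removalP w (w0 : forall u, (w u == 0_X) = (u == removal_root)) :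
  tree_removal v (val : removal w0 -> S).
Proof.
split=> // s; split=> [sv|[u <-]]; last exact: (valP (u : removal_vert)).
by exists (exist (fun u : S => u != v) s sv).
Qed.

Lemma removal_card w (w0 : forall u, (w u == 0_X) = (u == removal_root)) :
  (#|removal w0| < #|S|)%N.
Proof.
rewrite card_sig; apply/proper_card/properP; split.
  by apply/fintype.subsetP => s.
by exists v; rewrite ?inE// eqxx.
Qed.

Lemma delete_wt_eq0 (u : removal_vert) : (wt (val u) == 0_X) = (u == removal_root).
Proof. by rewrite wt_eq0 -val_eqE. Qed.

Lemma deletes_removal : deletes v (removal delete_wt_eq0).
Proof. by split=> //; exists val => //; exact: removalP. Qed.

Definition ghost_wt (u : removal_vert) : X :=
  if child (val u) v then wt (val u) (.) wt v else wt (val u).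

(** By (P3) a product of nonzero weights is nonzero. *)
Lemma ghost_wt_eq0 (u : removal_vert) : (ghost_wt u == 0_X) = (u == removal_root).
Proof.
rewrite -val_eqE/= /ghost_wt; case: ifP => [/andP[ur _]|_]; last exact: wt_eq0.
rewrite (negbTE ur); apply: contraNF vr => /eqP e; rewrite -wt_eq0.
have := enorm_op (wt (val u)) (wt v); rewrite e enorm0 => /esym/eqP.
rewrite paddr_eq0 ?enorm_ge0// => /andP[_ /eqP/mdist_positivity->//].
Qed.

Lemma ghosts_removal : degree2 v -> ghosts v (removal ghost_wt_eq0).
Proof. by split=> //; exists val => //; exact: removalP. Qed.

Variable b : X.
Hypothesis b0 : b != 0_X.

Lemma reweight_eq0 u : ((if u == v then b else wt u) == 0_X) = (u == root S).
Proof.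
by case: (eqVneq u v) => [->|_]; [rewrite (negbTE b0) (negbTE vr)|exact: wt_eq0].
Qed.

Definition reweight : dendrogram X :=
  Dendrogram (parent_root S) (@to_root _ _ S) reweight_eq0.

Lemma shrinks_reweight : shrinks v b reweight.
Proof. by split=> //; exists id => //; exact: tree_iso_id. Qed.

End Removal.

(** Shrink the edges one after the other, by induction on the number of edges whose
    weight is not yet the final one. *)
Lemma edit_path_reweight S S' (f : S' -> S) : tree_iso f ->
  edit_path S S' (\sum_u mdist (wt (f u)) (wt u)).
Proof.
have [n] := ubnP #|[set u | wt (f u) != wt u]|.
elim: n S f => // n IHn S f; rewrite ltnS => fn fi.
have [e|[u0]] := set_0Vmem [set u | wt (f u) != wt u].
  rewrite big1 => [|u _].
    apply: EditNil; exists f => // u; apply/eqP; move/setP/(_ u): e.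
    by rewrite !inE eq_sym => /negbFE.
  by move/setP/(_ u): e; rewrite !inE => /negbFE/eqP ->; exact: mdistxx.
rewrite inE => u0w; have [/bij_inj fI fr fp] := fi.
have u0r : u0 != root S'.
  apply: contraNneq u0w => ->; rewrite fr.
  have /eqP -> : wt (root S) == 0_X by rewrite wt_eq0.
  by rewrite eq_sym wt_eq0.
have vr : f u0 != root S by rewrite -fr (inj_eq fI).
have b0 : wt u0 != 0_X by rewrite wt_eq0.
rewrite (bigD1 u0)//=; apply: EditCons.
  exact: Shrink (shrinks_reweight vr b0).
have -> : \sum_(u | u != u0) mdist (wt (f u)) (wt u) =
    \sum_u mdist (wt (f u : reweight vr b0)) (wt u).
  rewrite [RHS](bigD1 u0)//= eqxx mdistxx add0r; apply: eq_bigr => u uu0.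
  by rewrite (inj_eq fI) (negbTE uu0).
apply: IHn; last by [].
apply: leq_trans fn; apply/proper_card/properP; split.
  apply/fintype.subsetP => u; rewrite !inE /= (inj_eq fI).
  by case: (eqVneq u u0) => [->|//]; rewrite eqxx.
by exists u0; rewrite !inE//= !eqxx.
Qed.

(** The parent of a vertex is the least element strictly above it. *)
Lemma order_iso_tree_iso S S' (g : S' -> S) : bijective g ->
  (forall u w, vle (g u) (g w) = vle u w) -> tree_iso g.
Proof.
move=> gb gv; have [h gK hK] := gb; have gI := can_inj gK.
have gr : g (root S') = root S.
  by apply/eqP; rewrite -root_vle -[X in vle _ X]/(g _) -[root S]hK gv vle_root.
split=> // w; have [->|wr] := eqVneq w (root S').
  by rewrite parent_root gr parent_root.
have gwr : g w != root S by rewrite -gr (inj_eq gI).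
apply: vle_anti.
- rewrite -[parent (g w)]hK gv -vle_neq_parent; first by rewrite -gv hK vle_parent.
  by rewrite -(inj_eq gI) hK eq_sym parent_neq.
- rewrite -vle_neq_parent; first by rewrite gv vle_parent.
  by rewrite (inj_eq gI) eq_sym parent_neq.
Qed.

End Realisation.

(** * Couplings are realised by edit paths *)

Section Realise.
Context {R : realType} {X : editableSpace R}.
Implicit Types S : dendrogram X.

Local Notation "0_X" := (ezero X).
Local Notation "x (.) y" := (eop X x y) (at level 40, left associativity).

(** The form of both sides of a coupling that no deletion or ghosting can reduce
    further. *)
Definition singleton_cover S (I : finType) (A : I -> {set S}) :=
  (forall v, v != root S -> exists i, v \in A i) /\
  (forall i u v, u \in A i -> v \in A i -> u = v).

(** An edge without label can be deleted. If all edges have labels, a non-minimal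
    edge of a chain has degree 2, so that it can be ghosted: a second child would have
    a label which is neither in the chain nor comparable with all of it. *)
Lemma coupling_reduce S S' (I : finType) (A : I -> {set S}) (B : I -> {set S'}) :
  coupling A B -> two_sided A B -> singleton_cover A \/
  exists S2 (A2 : I -> {set S2}) c, [/\ edit S S2 c, (#|S2| < #|S|)%N, coupling A2 B
    & c + dnorm S2 - total_gain A2 B <= dnorm S - total_gain A B].
Proof.
move=> AB twoAB; have [cA cB cAB] := AB.
have [/existsP[v /andP[vr /forallP vA]]|/existsPn cov] :=
    boolP [exists v, (v != root S) && [forall i, v \notin A i]].
  right; have dv := deletes_removal vr; have rv := removalP (delete_wt_eq0 vr).
  have fe := removal_embedding vr rv.
  exists (removal (delete_wt_eq0 vr)), (fun i => val @^-1: A i), (mdist (wt v) 0_X); split.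
  - exact: Delete.
  - exact: removal_card.
  - exact: coupling_preim.
  - have -> : dnorm S = mdist (wt v) 0_X + dnorm (removal (delete_wt_eq0 vr)).
      by rewrite !dnormE (sum_removal _ rv).
    rewrite lerD2l lerN2; apply: total_gain_mono => i.
    rewrite le_eqVlt; apply/orP; left; apply/eqP; congr gain.
    have imE : A i = val @: (val @^-1: A i : {set removal (delete_wt_eq0 vr)}).
      apply/setP => s; apply/idP/imsetP => [si|[u + ->]]; last by rewrite inE.
      have [_ fim _ _] := rv; have sv : s != v by apply: contraTneq si => ->.
      by have [u us] := (fim s).1 sv; exists u; rewrite // inE us.
    rewrite [in LHS]imE; exact: (mass_imset _ (embedding_inj fe)).
have {}cov v : v != root S -> exists i, v \in A i.
  by move=> vr; have := cov v; rewrite vr => /forallPn[i]; rewrite negbK; exists i.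
have [/existsP[i /existsP[u0 /existsP[v0 /and3P[u0i v0i uv0]]]]|/existsPn sing] :=
    boolP [exists i, exists u, exists v, [&& u \in A i, v \in A i & u != v]]; last first.
  left; split=> // i u v ui vi; apply/eqP; apply: contraNT (sing i) => uv.
  by apply/existsP; exists u; apply/existsP; exists v; rewrite ui vi.
right.
have [u [v [ui vi uv le_uv]]] : exists u v, [/\ u \in A i, v \in A i, u != v & vle u v].
  have /orP[le|le] := chains_cmp cA u0i v0i; first by exists u0, v0.
  by exists v0, u0; rewrite eq_sym.
have nroot w k : w \in A k -> w != root S.
  by apply: contraTneq => ->; exact: (chains_root cA).
have vr := nroot _ _ vi.
have [z zv uz] := child_above le_uv uv.
have zle : vle z v by case/andP: zv => _ /eqP <-; exact: vle_parent.
have childN t : child t v -> ~~ vle v t.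
  by move=> /andP[tr /eqP <-]; exact: parent_vleN.
have [wi wiB] := two_sided_ex twoAB ui.
(* The child of v above u is caught between two vertices with the label i. *)
have zi : z \in A i.
  have /andP[zr _] := zv; have [l zl] := cov _ zr.
  have [<-//|li] := eqVneq l i; have [wl wlB] := two_sided_ex twoAB zl.
  have il : i != l by rewrite eq_sym.
  case/negP: (childN _ zv); rewrite (cAB _ _ _ _ _ _ il vi zl wiB wlB).
  by rewrite -(cAB _ _ _ _ _ _ il ui zl wiB wlB).
have cz t : child t v = (t == z).
  apply/idP/eqP => [tv|->//]; apply/eqP/negPn/negP => tz.
  have /andP[tr /eqP pt] := tv; have /andP[zr /eqP pz] := zv.
  have tle : vle t v by rewrite -pt vle_parent.
  have : vle t z || vle z t.
    have [k tk] := cov _ tr; have [kE|ki] := eqVneq k i.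
      by rewrite kE in tk; exact: (chains_cmp cA tk zi).
    have [wk wkB] := two_sided_ex twoAB tk.
    rewrite (cAB _ _ _ _ _ _ ki tk zi wkB wiB) -(cAB _ _ _ _ _ _ ki tk vi wkB wiB).
    by rewrite tle.
  case/orP; first by rewrite vle_neq_parent// pt; exact/negP/childN.
  by rewrite vle_neq_parent 1?eq_sym// pz; exact/negP/childN.
have v2 : degree2 v.
  rewrite /degree2 vr (_ : [set t | child t v] = [set z]) ?cards1//.
  by apply/setP => t; rewrite !inE cz.
have gv := ghosts_removal vr v2; have rv := removalP (ghost_wt_eq0 vr).
have fe := removal_embedding vr rv.
have zv' : z != v by apply: contraTneq zle => zE; case/negP: (childN _ zv); rewrite zE.
exists (removal (ghost_wt_eq0 vr)), (fun i => val @^-1: A i), 0; split.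
- exact: Ghost gv.
- exact: removal_card.
- exact: coupling_preim.
- rewrite add0r (dnorm_ghost gv) lerD2l lerN2; apply: total_gain_mono => k.
  rewrite (mass_ghost rv cz zv')//.
  apply/idP/idP => [vk|zk]; first by rewrite -(chains_disj cA vi vk).
  by rewrite -(chains_disj cA zi zk).
Qed.

(** The labels define a bijection that preserves the order, hence an isomorphism of
    trees, and it remains to adjust the weights. *)
Lemma path_of_singleton_covers S S' (I : finType) (A : I -> {set S}) (B : I -> {set S'}) :
  coupling A B -> two_sided A B -> singleton_cover A -> singleton_cover B ->
  exists2 c, edit_path S S' c & c <= dnorm S + dnorm S' - total_gain A B.
Proof.
move=> [cA cB cAB] twoAB [covA singA] [covB singB].
(* The bijection, with the two roots corresponding to each other. *)
pose rel (u : S) (w : S') :=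
  (u = root S /\ w = root S') \/ exists2 i, u \in A i & w \in B i.
have relL u w w' : rel u w -> rel u w' -> w = w'.
  case=> [[-> ->]|[i ui wi]] [[uE ->]|[j uj wj]] //.
  - by have := chains_root cA j; rewrite uj.
  - by have := chains_root cA i; rewrite -uE ui.
  - by rewrite -(chains_disj cA ui uj) in wj; exact: singB wi wj.
have relR u u' w : rel u w -> rel u' w -> u = u'.
  case=> [[-> ->]|[i ui wi]] [[-> wE]|[j uj wj]] //.
  - by have := chains_root cB j; rewrite wj.
  - by have := chains_root cB i; rewrite -wE wi.
  - by rewrite -(chains_disj cB wi wj) in uj; exact: singA ui uj.
have relV u u' w w' : rel u w -> rel u' w' -> vle u u' = vle w w'.
  case=> [[-> ->]|[i ui wi]] [[-> ->]|[j uj wj]].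
  - by rewrite !vle_refl.
  - rewrite !root_vle; have /negbTE -> : u' != root S.
      by apply: contraTneq uj => ->; exact: chains_root.
    by symmetry; apply/negbTE; apply: contraTneq wj => ->; exact: chains_root.
  - by rewrite !vle_root.
  - have [ij|ij] := eqVneq i j; last exact: (cAB i j).
    rewrite -ij in uj wj.
    by rewrite (singA _ _ _ ui uj) (singB _ _ _ wi wj) !vle_refl.
have exR w : exists u, rel u w.
  have [->|wr] := eqVneq w (root S'); first by exists (root S); left.
  have [i wi] := covB _ wr; have [u ui] := two_sided_ex (two_sided_sym twoAB) wi.
  by exists u; right; exists i.
have exL u : exists w, rel u w.
  have [->|ur] := eqVneq u (root S); first by exists (root S'); left.
  have [i ui] := covA _ ur; have [w wi] := two_sided_ex twoAB ui.
  by exists w; right; exists i.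
have [g gP] := choice exR; have [h hP] := choice exL.
have gi : tree_iso g.
  apply: order_iso_tree_iso => [|w w']; last exact: relV.
  exists h => [w|u]; first exact: relL (hP _) (gP _).
  exact: relR (gP _) (hP _).
exists (\sum_w mdist (wt (g w)) (wt w)); first exact: edit_path_reweight.
rewrite lerBrDr -lerBrDl.
have -> : dnorm S + dnorm S' - \sum_w mdist (wt (g w)) (wt w) =
    \sum_w gain (wt (g w)) (wt w).
  rewrite !dnormE -(dnorm_iso (fun s => enorm (wt s)) gi) -big_split/= -sumrB.
  by apply: eq_bigr.
apply: le_trans (_ : _ <= \sum_i \sum_w (w \in B i)%:R * gain (wt (g w)) (wt w)) _.
  apply: ler_sum => i _; have [Bi|[w wi]] := set_0Vmem (B i).
    rewrite Bi mass0 gain0r; apply: sumr_ge0 => w _.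
    by rewrite mulr_ge0// gain_ge0.
  have ui : g w \in A i.
    have [u ui] := two_sided_ex (two_sided_sym twoAB) wi.
    by rewrite (relR _ u w (gP w))//; right; exists i.
  have -> : B i = [set w].
    by apply/setP => w'; rewrite inE; apply/idP/eqP => [/singB/(_ wi)//|->].
  have -> : A i = [set g w].
    by apply/setP => u'; rewrite inE; apply/idP/eqP => [/singA/(_ ui)//|->].
  rewrite /mass !big_set1 (bigD1 w)//= inE eqxx mul1r lerDl.
  by apply: sumr_ge0 => w' _; rewrite mulr_ge0// gain_ge0.
rewrite exchange_big/=; apply: ler_sum => w _.
exact: (chains_sum_le w cB (gain_ge0 _ _)).
Qed.

(** Induction on the total number of vertices. A reduction of the second tree is an
    edit to be read backwards, at the end of the path. *)
Lemma path_of_coupling S S' (I : finType) (A : I -> {set S}) (B : I -> {set S'}) :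
  coupling A B ->
  exists2 c, edit_path S S' c & c <= dnorm S + dnorm S' - total_gain A B.
Proof.
have [n] := ubnP (#|S| + #|S'|)%N.
elim: n S S' A B => // n IHn S S' A0 B0; rewrite ltnS => nS.
move=> /coupling_two_sided[A [B [AB twoAB <-]]].
have [eA|[S2 [A2 [c [e lt2 AB2 le2]]]]] := coupling_reduce AB twoAB; last first.
  have [|c' p' le'] := IHn _ _ _ _ _ AB2.
    by apply: leq_trans nS; rewrite ltn_add2r.
  by exists (c + c'); [exact: EditCons e p'|lra].
have BA := coupling_sym AB.
have [eB|[S2 [B2 [c [e lt2 BA2 le2]]]]] := coupling_reduce BA (two_sided_sym twoAB).
  exact: path_of_singleton_covers.
have [|c' p' le'] := IHn _ _ _ _ _ (coupling_sym BA2).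
  by apply: leq_trans nS; rewrite ltn_add2l.
exists (c' + c); first exact: edit_path_rcons p' (edit_sym e).
rewrite total_gain_sym in le'; rewrite total_gain_sym; lra.
Qed.

(** It is realised by the deletion of all edges of one tree and the insertion of all
    edges of the other, so that edit paths always exist. *)
Lemma empty_coupling S S' :
  coupling (fun _ : void => set0 : {set S}) (fun _ : void => set0 : {set S'}).
Proof. by split=> [||[]//]; split=> [[]|[]|[]]. Qed.

Lemma has_inf_edit_path S S' : has_inf [set c : R | edit_path S S' c]%classic.
Proof.
split; last by exists 0 => c; exact: edit_path_ge0.
by have [c p _] := path_of_coupling (empty_coupling S S'); exists c.
Qed.

Lemma dE_le_path S S' c : edit_path S S' c -> dE S S' <= c.
Proof. by move=> p; apply: (ge_inf (has_inf_edit_path S S').2). Qed.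

Lemma dE_le_coupling S S' (I : finType) (A : I -> {set S}) (B : I -> {set S'}) :
  coupling A B -> dE S S' <= dnorm S + dnorm S' - total_gain A B.
Proof. by move=> /path_of_coupling[c /dE_le_path p]; exact: le_trans. Qed.

Lemma dE_ge_matchings S S' (x : R) :
  (forall M : matching S S', x <= dnorm S + dnorm S' - mgain M) -> x <= dE S S'.
Proof.
move=> h; apply: lb_le_inf => [|c p]; first exact: (has_inf_edit_path S S').1.
by have [M Mc] := matching_of_path p; exact: le_trans (h M) Mc.
Qed.

Lemma matching_near_dE S S' (e : R) : 0 < e ->
  exists M : matching S S', dnorm S + dnorm S' - mgain M < dE S S' + e.
Proof.
move=> e0; have [c p lt] := inf_adherent e0 (has_inf_edit_path S S').
by have [M Mc] := matching_of_path p; exists M; exact: le_lt_trans Mc lt.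
Qed.

End Realise.

(** * Segments and the objective *)

Section Segments.
Context {R : realType} {X : editableSpace R}.
Implicit Types S : dendrogram X.

Local Notation "0_X" := (ezero X).

Lemma sub_vle S (x : S) (u w : sub x) : vle u w = vle (val u) (val w).
Proof.
apply/idP/idP => [/vleP[n <-]|/vleP[n]].
  elim: n => [|n IHn]; first exact: vle_refl.
  apply: vle_trans IHn _; rewrite iterS; set t := iter n _ _.
  change (vle (val t) (if val t == x then x else parent (val t))).
  by case: eqP => [->|_]; [exact: vle_refl|exact: vle_parent].
elim: n u => [|n IHn] u; first by move=> /= /val_inj ->; exact: vle_refl.
rewrite iterSr; have [ux|ux] := eqVneq (val u) x.
  move=> e; rewrite (_ : w = u) ?vle_refl//; apply: val_inj.
  have uw : vle (val u) (val w) by apply/vleP; exists n.+1; rewrite iterSr.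
  by rewrite ux in uw *; apply: vle_anti uw; exact: (valP w).
move=> e; apply: vle_trans (vle_parent u) _; apply: IHn.
by rewrite /= (negbTE ux).
Qed.

Lemma bot_neq_root S (p : segment S) : bot p != root S.
Proof.
apply: contraNneq (valP p); rewrite /bot /anc => ->.
by rewrite iter_parent_root.
Qed.

Lemma top_neq_root S (p : segment S) : top p != root S.
Proof. exact: (valP p). Qed.

Lemma bot_vle_top S (p : segment S) : vle (bot p) (top p).
Proof. exact: fconnect_iter. Qed.

Lemma segment_exists S (b t : S) : vle b t -> t != root S ->
  exists p : segment S, bot p = b /\ top p = t.
Proof.
move=> /vleP[n nt] tr; have nr : anc b n != root S by rewrite /anc nt.
by exists (exist _ (b, Ordinal (anc_bound nr)) nr); split.
Qed.

Definition segset S (p : segment S) : {set S} :=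
  [set v | vle (bot p) v && vle v (top p)].

Lemma seg_wtE S (p : segment S) : seg_wt p = mass (segset p).
Proof. by apply: eq_bigl => v; rewrite inE. Qed.

Lemma leaf_sumE S (m : segment S -> nat) l :
  (\sum_(v | vle l v) \sum_(p in Phi v) m p = \sum_(p | vle l (top p)) m p)%N.
Proof.
rewrite [RHS](partition_big (@top _ _ _) (fun v => vle l v))//=.
apply: eq_bigr => v lv; apply: eq_bigl => p; rewrite inE.
by case: eqP => [->|]; rewrite ?lv ?andbF.
Qed.

(** Two vertices are comparable if and only if they are above a common leaf. The
    index [y] stands for the segment of the other tree, which may be on either side
    of the pair. *)
Lemma leaf_constraintP S (Y : finType) (d : segment S -> Y -> bool) :
  reflect (forall p y p' y', d p y -> d p' y' -> (p, y) != (p', y') ->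
             ~~ vle (top p) (top p'))
          (leaf_constraint (fun p => \sum_y d p y)%N).
Proof.
have sumE l : (\sum_(v | vle l v) \sum_(p in Phi v) \sum_y d p y
    = \sum_(z | vle l (top z.1)) d z.1 z.2)%N.
  rewrite leaf_sumE (pair_big_dep (fun p => vle l (top p)) (fun _ _ => true))/=.
  by apply: eq_bigl => z; rewrite andbT.
apply: (iffP forallP) => [h p y p' y' dp dp' neq|h l].
  have [l lf lp] := leaf_below (top p); apply/negP => pp'.
  have := h l; rewrite lf/= sumE (bigD1 (p, y))//= (bigD1 (p', y'))/=; last first.
    by rewrite eq_sym neq andbT (vle_trans lp).
  by rewrite dp dp'.
apply/implyP => _; rewrite sumE.
have [/existsP[[p y] /andP[/= lp dp]]|/existsPn nz] :=
    boolP [exists z, vle l (top z.1) && d z.1 z.2]; last first.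
  by rewrite big1// => z lz; have := nz z; rewrite lz/= => /negbTE ->.
rewrite (bigD1 (p, y))//= dp big1 => [//|[p' y'] /= /andP[lp' neq]].
apply/eqP; rewrite eqb0; apply/negP => dp'; move: neq; rewrite eq_sym => neq.
have := vle_up lp lp'; rewrite (negbTE (h _ _ _ _ dp dp' neq)) /=.
by rewrite eq_sym in neq; rewrite (negbTE (h _ _ _ _ dp' dp neq)).
Qed.

(** An edge of a segment is counted once, in [Cvar] if it is the bottom of the segment
    and in [Gvar] otherwise; exchange the sums over edges and segments. *)
Lemma FD_halfE S (m : segment S -> nat) :
  FD_half m = dnorm S - \sum_p (m p)%:R * enorm (seg_wt p).
Proof.
rewrite /FD_half /dnorm.
have -> : \sum_p (m p)%:R * enorm (seg_wt p) =
    \sum_(v | v != root S) (Cvar m v + Gvar m v) * enorm (wt v).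
  have DE v : Cvar m v + Gvar m v = \sum_(p | v \in segset p) (m p)%:R.
    rewrite /Cvar /Gvar !natr_sum [RHS](bigID (fun p => bot p == v))/=.
    congr +%R; apply: eq_bigl => p; rewrite inE.
      by case: eqP => [<-|]; rewrite ?andbF// vle_refl bot_vle_top.
    by rewrite /vlt; case: (bot p == v); rewrite ?andbF ?andbT.
  under [RHS]eq_bigr do rewrite DE mulr_suml.
  rewrite (exchange_big_dep predT)//=; apply: eq_bigr => p _.
  rewrite seg_wtE enorm_prod mulr_sumr; apply: eq_bigl => v.
  case: eqP => [->|_]//=; rewrite inE root_vle.
  by rewrite (negbTE (top_neq_root p)) andbF.
by rewrite -sumrB; apply: eq_bigr => v _; rewrite /Dvar /enorm; lra.
Qed.

Lemma Fm_halfE S (m : segment S -> nat) :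
  Fm_half m = \sum_p (m p)%:R * dnorm (sub (bot p)).
Proof.
rewrite /Fm_half [RHS](partition_big (@bot _ _ _) (fun v => v != root S))/=; last first.
  by move=> p _; exact: bot_neq_root.
apply: eq_bigr => v _; rewrite /Cvar natr_sum mulr_suml.
by apply: eq_bigr => p /eqP ->.
Qed.

Section Objective.
Variables Tx Ty : dendrogram X.

(** What a variable equal to 1 saves: the gain on the two segments themselves, plus
    the savings of an optimal edit path between the subtrees below them. *)
Definition saving (z : segment Tx * segment Ty) : R :=
  gain (seg_wt z.1) (seg_wt z.2) +
  (dnorm (sub (bot z.1)) + dnorm (sub (bot z.2)) - dE (sub (bot z.1)) (sub (bot z.2))).

Lemma objectiveE (delta : variables Tx Ty) :
  FC delta + FD delta - Fm delta + FS delta =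
  dnorm Tx + dnorm Ty - \sum_z (delta z)%:R * saving z.
Proof.
have pairE (F : segment Tx * segment Ty -> R) :
    \sum_z F z = \sum_p \sum_q F (p, q).
  by rewrite pair_big; apply: eq_bigr => -[].
have m1 (F : segment Tx -> R) :
    \sum_p (marg1 delta p)%:R * F p = \sum_z (delta z)%:R * F z.1.
  by rewrite pairE; apply: eq_bigr => p _; rewrite /marg1 natr_sum mulr_suml.
have m2 (F : segment Ty -> R) :
    \sum_q (marg2 delta q)%:R * F q = \sum_z (delta z)%:R * F z.2.
  rewrite pairE exchange_big/=; apply: eq_bigr => q _.
  by rewrite /marg2 natr_sum mulr_suml.
have FSE : FS delta = \sum_z (delta z)%:R * dE (sub (bot z.1)) (sub (bot z.2)).
  rewrite [RHS]pairE/= [RHS](partition_big (@bot _ _ _) (fun v => v != root Tx))/=; last first.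
    by move=> p _; exact: bot_neq_root.
  apply: eq_bigr => v _.
  under [RHS]eq_bigr => p pv.
    rewrite (partition_big (@bot _ _ _) (fun w => w != root Ty))/=; last first.
      by move=> q _; exact: bot_neq_root.
    over.
  rewrite exchange_big/=; apply: eq_bigr => w _.
  rewrite natr_sum mulr_sumr; apply: eq_bigr => p /eqP <-.
  rewrite natr_sum mulr_sumr; apply: eq_bigr => q /eqP <-.
  by rewrite mulrC.
have FCE : FC delta = \sum_z (delta z)%:R * mdist (seg_wt z.1) (seg_wt z.2).
  by rewrite [RHS]pairE; apply: eq_bigr => p _; apply: eq_bigr => q _; rewrite mulrC.
rewrite FCE FSE /FD /Fm !FD_halfE !Fm_halfE !m1 !m2.
rewrite (_ : \sum_z (delta z)%:R * saving z =
  \sum_z (delta z)%:R * enorm (seg_wt z.1) + \sum_z (delta z)%:R * enorm (seg_wt z.2)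
  - \sum_z (delta z)%:R * mdist (seg_wt z.1) (seg_wt z.2)
  + \sum_z (delta z)%:R * dnorm (sub (bot z.1)) + \sum_z (delta z)%:R * dnorm (sub (bot z.2))
  - \sum_z (delta z)%:R * dE (sub (bot z.1)) (sub (bot z.2))); first by lra.
rewrite -!(sumrB, big_split)/=; apply: eq_bigr => z _.
by rewrite /saving /gain; lra.
Qed.

End Objective.

End Segments.

(** * Gluing couplings along incomparable segments *)

Section Glue.
Context {R : realType} {X : editableSpace R}.
Implicit Types S : dendrogram X.

Lemma sum_option (I : finType) (F : option I -> R) :
  \sum_o F o = F None + \sum_i F (Some i).
Proof. by rewrite ![index_enum _]unlock [@Finite.enum in LHS]unlock/= big_cons big_map. Qed.

(** Both trees are treated alike, hence the construction for one family of segments.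
    The label [None] is the one of the segment itself, and [Some i] are the labels of
    the coupling on the subtree below its bottom. *)
Section OneSide.
Variables (S : dendrogram X) (J : finType) (d : pred J) (p : J -> segment S).
Variables (L : J -> finType) (C : forall j, L j -> {set sub (bot (p j))}).

Definition glue (l : {j : J & option (L j)}) : {set S} :=
  if d (tag l) then
    if tagged l is Some i then val @: C i else segset (p (tag l))
  else set0.

Local Notation lab j o := (existT (fun j => option (L j)) j o).

Hypothesis Cch : forall j, chains (@C j).
Hypothesis dincomp : forall j j', d j -> d j' -> j != j' -> ~~ vle (top (p j)) (top (p j')).

Lemma glue_None j u :
  (u \in glue (lab j None)) = d j && (u \in segset (p j)).
Proof. by rewrite /glue/=; case: (d j); rewrite ?inE. Qed.

Lemma glue_Some j (i : L j) u : u \in glue (lab j (Some i)) ->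
  d j /\ exists u' : sub (bot (p j)), [/\ u' \in C i, val u' = u & ~~ vle (bot (p j)) u].
Proof.
rewrite /glue/=; case: (d j); last by rewrite inE.
move=> /imsetP[u' u'i ->]; split=> //; exists u'; split=> //.
apply: contraTN u'i => bu; rewrite (_ : u' = root (sub (bot (p j)))).
  exact: (chains_root (@Cch j)).
by apply: val_inj; apply: vle_anti => //; exact: (valP u').
Qed.

Lemma glue_le_bot j (i : L j) u : u \in glue (lab j (Some i)) -> vle u (bot (p j)).
Proof. by move=> /glue_Some[_ [u' [_ <- _]]]; exact: (valP u'). Qed.

Lemma glue_tag l u : u \in glue l -> d (tag l) /\ vle u (top (p (tag l))).
Proof.
case: l => j [i|]; last by rewrite glue_None inE => /and3P[dj _].
move=> ui; have [dj _] := glue_Some ui; split=> //.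
exact: vle_trans (glue_le_bot ui) (bot_vle_top _).
Qed.

Lemma glue_tag_neq l l' u u' : u \in glue l -> u' \in glue l' ->
  tag l != tag l' -> ~~ vle u u'.
Proof.
move=> /glue_tag[dl ul] /glue_tag[dl' ul'] ll'; apply/negP => uu'.
have := vle_up ul (vle_trans uu' ul').
rewrite (negbTE (dincomp dl dl' ll')) /=; apply/negP; apply: dincomp => //.
by rewrite eq_sym.
Qed.

Lemma glue_chains : chains glue.
Proof.
split.
- move=> l; apply/negP => /glue_tag[_]; rewrite root_vle.
  by rewrite (negbTE (top_neq_root _)).
- move=> l l' u ul ul'; have [ll'|] := eqVneq (tag l) (tag l'); last first.
    by move/(glue_tag_neq ul ul'); rewrite vle_refl.
  case: l l' ll' ul ul' => j o [j' o'] /= jj'; subst j'.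
  case: o o' => [i|] [i'|] //.
  + move=> /glue_Some[_ [a [ai <- _]]] /glue_Some[_ [b [bi /val_inj ba _]]].
    by rewrite ba in bi; rewrite (chains_disj (@Cch j) ai bi).
  + move=> /glue_Some[_ [_ [_ _ /negbTE bu]]].
    by rewrite glue_None inE bu andbF.
  + move=> + /glue_Some[_ [_ [_ _ /negbTE bu]]].
    by rewrite glue_None inE bu andbF.
- move=> [j [i|]] u v.
    move=> /glue_Some[_ [a [ai <- _]]] /glue_Some[_ [b [bi <- _]]].
    by rewrite -!sub_vle; exact: (chains_cmp (@Cch j) ai bi).
  rewrite !glue_None !inE => /and3P[_ bu _] /and3P[_ bv _].
  exact: vle_up bu bv.
Qed.

Lemma glue_mass_None j : d j ->
  mass (glue (lab j None)) = seg_wt (p j).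
Proof.
move=> dj; rewrite seg_wtE; congr mass; apply/setP => u.
by rewrite glue_None dj.
Qed.

Lemma glue_mass_Some j (i : L j) : d j -> mass (glue (lab j (Some i))) = mass (C i).
Proof.
move=> dj; rewrite /glue/= dj /mass big_imset/=; last by move=> a b _ _; exact: val_inj.
apply: eq_bigr => u ui; rewrite /sub_wt (_ : u == _ = false)//.
by apply: contraTF ui => /eqP ->; exact: (chains_root (@Cch j)).
Qed.

Lemma glue_mass_out l : ~~ d (tag l) -> mass (glue l) = ezero X.
Proof. by rewrite /glue => /negbTE ->; exact: mass0. Qed.

End OneSide.

Lemma coupling_glue S S' (J : finType) (d : pred J) (p : J -> segment S)
    (q : J -> segment S') (M : forall j, matching (sub (bot (p j))) (sub (bot (q j)))) :
  (forall j j', d j -> d j' -> j != j' -> ~~ vle (top (p j)) (top (p j'))) ->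
  (forall j j', d j -> d j' -> j != j' -> ~~ vle (top (q j)) (top (q j'))) ->
  exists (I : finType) (A : I -> {set S}) (B : I -> {set S'}),
    coupling A B /\ total_gain A B =
      \sum_(j | d j) (gain (seg_wt (p j)) (seg_wt (q j)) + mgain (M j)).
Proof.
move=> dp dq.
have cl j : chains (@lpart _ _ _ _ (M j)) by have [] := matchingP (M j).
have cr j : chains (@rpart _ _ _ _ (M j)) by have [] := matchingP (M j).
have cm j : compatible (@lpart _ _ _ _ (M j)) (@rpart _ _ _ _ (M j)).
  by have [] := matchingP (M j).
pose A := glue d (fun j => @lpart _ _ _ _ (M j)).
pose B := glue d (fun j => @rpart _ _ _ _ (M j)).
exists {j : J & option (label (M j))}, A, B; split.
  split; [exact: glue_chains|exact: glue_chains|].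
  move=> l l' u u' w w' ll' ul u'l' wl w'l'.
  have [tt'|tt'] := eqVneq (tag l) (tag l'); last first.
    by rewrite (negbTE (glue_tag_neq cl dp ul u'l' tt'))
      (negbTE (glue_tag_neq cr dq wl w'l' tt')).
  case: l l' tt' ll' ul u'l' wl w'l' => j o [j' o'] /= jj'; subst j'.
  case: o o' => [i|] [i'|] ll' ul u'l' wl w'l'.
  - have [_ [a [ai <- _]]] := glue_Some cl ul.
    have [_ [a' [ai' <- _]]] := glue_Some cl u'l'.
    have [_ [b [bi <- _]]] := glue_Some cr wl.
    have [_ [b' [bi' <- _]]] := glue_Some cr w'l'.
    rewrite -!sub_vle; apply: (cm j i i') => //.
    by apply: contraNneq ll' => ->.
  - have := glue_le_bot cl ul; have := glue_le_bot cr wl.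
    move: u'l' w'l'; rewrite !glue_None !inE => /and3P[_ bu' _] /and3P[_ bw' _].
    by move=> wb ub; rewrite (vle_trans ub bu') (vle_trans wb bw').
  - have [_ [_ [_ _ bu]]] := glue_Some cl u'l'.
    have [_ [_ [_ _ bw]]] := glue_Some cr w'l'.
    move: ul wl; rewrite !glue_None !inE => /and3P[_ bu' _] /and3P[_ bw' _].
    have -> : vle u u' = false by apply: contraNF bu => uu'; exact: vle_trans bu' uu'.
    by symmetry; apply: contraNF bw => ww'; exact: vle_trans bw' ww'.
  - by rewrite eqxx in ll'.
pose lab j (o : option (label (M j))) := existT (fun j => option (label (M j))) j o.
have sumT (F : {j : J & option (label (M j))} -> R) :
    \sum_l F l = \sum_j \sum_(o : option (label (M j))) F (lab j o).
  rewrite (sig_big_dep _ _ (fun j o => F (lab j o)))/=.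
  by apply: eq_bigr => -[].
rewrite /total_gain sumT [RHS]big_mkcond/=; apply: eq_bigr => j _.
case: ifPn => dj; last by rewrite big1// => o _; rewrite !glue_mass_out ?gain0l.
rewrite sum_option !glue_mass_None//; congr +%R; apply: eq_bigr => i _.
by rewrite !glue_mass_Some.
Qed.

End Glue.

(** * Reading the variables off a coupling *)

Section FromCouplings.
Context {R : realType} {X : editableSpace R}.
Implicit Types S : dendrogram X.

Lemma chain_bottom S (C : {set S}) : C != set0 ->
  {in C &, forall u v, vle u v || vle v u} -> exists2 b, b \in C & {in C, forall u, vle b u}.
Proof.
move=> /set0Pn[u0 u0C] cC; case: (arg_minnP (@height _ _ S) u0C) => b bC bmin.
exists b => // u uC; have /orP[//|ub] := cC _ _ bC uC.
have [->//|neq] := eqVneq u b.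
by have := height_lt ub neq; rewrite ltnNge bmin.
Qed.

Lemma chain_top S (C : {set S}) : C != set0 ->
  {in C &, forall u v, vle u v || vle v u} -> exists2 t, t \in C & {in C, forall u, vle u t}.
Proof.
move=> /set0Pn[u0 u0C] cC; case: (arg_maxnP (@height _ _ S) u0C) => t tC tmax.
exists t => // u uC; have /orP[tu|//] := cC _ _ tC uC.
have [->//|neq] := eqVneq u t.
by have := height_lt tu; rewrite eq_sym neq ltnNge => /(_ isT)/negP[]; exact: tmax.
Qed.

Lemma chain_segment S (I : finType) (A : I -> {set S}) k : chains A -> A k != set0 ->
  exists p : segment S, [/\ bot p \in A k, top p \in A k & A k \subset segset p].
Proof.
move=> cA Ak; have cmp : {in A k &, forall u v, vle u v || vle v u}.
  by move=> u v uk vk; exact: (chains_cmp cA uk vk).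
have [b bk bP] := chain_bottom Ak cmp; have [t tk tP] := chain_top Ak cmp.
have tr : t != root S by apply: contraTneq tk => ->; exact: chains_root.
have [p [pb pt]] := segment_exists (bP _ tk) tr.
exists p; rewrite pb pt; split=> //; apply/fintype.subsetP => u uk.
by rewrite inE pb pt bP// tP.
Qed.

Lemma coupling_subtree S S' (x : S) (y : S') (I : finType) (A : I -> {set S})
    (B : I -> {set S'}) :
  (forall i, x \notin A i) -> (forall i, y \notin B i) -> coupling A B ->
  coupling (fun i => val @^-1: A i : {set sub x}) (fun i => val @^-1: B i : {set sub y}).
Proof.
have half (T : dendrogram X) (z : T) (C : I -> {set T}) : (forall i, z \notin C i) ->
    chains C -> chains (fun i => val @^-1: C i : {set sub z}).
  move=> zC cC; split=> [i|i j u|i u v]; rewrite !inE.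
  - exact: zC.
  - exact: (chains_disj cC).
  - by rewrite !sub_vle; exact: (chains_cmp cC).
move=> xA yB [cA cB cAB]; split; [exact: half|exact: half|].
move=> i j u u' w w' ij; rewrite !inE !sub_vle; exact: cAB.
Qed.

Lemma mass_subtree S (x : S) (A : {set S}) : x \notin A -> {in A, forall u, vle u x} ->
  mass (val @^-1: A : {set sub x}) = mass A.
Proof.
move=> xA Ax; have imE : A = val @: (val @^-1: A : {set sub x}).
  apply/setP => s; apply/idP/imsetP => [sA|[u + ->]]; last by rewrite inE.
  by exists (exist (fun u : S => vle u x) s (Ax _ sA)); rewrite ?inE.
rewrite [in RHS]imE [RHS]big_imset/=; last by move=> a b _ _; exact: val_inj.
apply: eq_bigr => u; rewrite inE => uA; rewrite [LHS]/= /sub_wt (_ : u == _ = false)//.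
by apply: contraNF xA => /eqP uE; rewrite uE in uA.
Qed.

Section Outermost.
Variables (S S' : dendrogram X) (I : finType) (A : I -> {set S}) (B : I -> {set S'}).
Hypotheses (AB : coupling A B) (twoAB : two_sided A B).

Let cA : chains A. Proof. by case: AB. Qed.
Let cB : chains B. Proof. by case: AB. Qed.
Let cAB : compatible A B. Proof. by case: AB. Qed.

(** In a two-sided coupling neither the choice of the two vertices nor that of the
    tree matters ([belowE], [below_right]). *)
Definition below i k := (i != k) && [exists u in A i, exists v in A k, vle u v].

Lemma belowE i k u v : i != k -> u \in A i -> v \in A k -> below i k = vle u v.
Proof.
move=> ik ui vk; rewrite /below ik; apply/exists_inP/idP => [[u' ui' /exists_inP[v' vk']]|].
  have [w wi] := two_sided_ex twoAB ui; have [w' wk] := two_sided_ex twoAB vk.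
  by rewrite (cAB ik ui' vk' wi wk) -(cAB ik ui vk wi wk).
by move=> uv; exists u => //; apply/exists_inP; exists v.
Qed.

Lemma below_right i k w w' : i != k -> w \in B i -> w' \in B k -> below i k = vle w w'.
Proof.
move=> ik wi wk; have [u ui] := two_sided_ex (two_sided_sym twoAB) wi.
have [v vk] := two_sided_ex (two_sided_sym twoAB) wk.
by rewrite (belowE ik ui vk) (cAB ik ui vk wi wk).
Qed.

Definition outermost k := (A k != set0) && [forall j, ~~ below k j].

(** Go up from a vertex with the label [i] to the highest vertex with a label. *)
Lemma outermost_above i : A i != set0 ->
  exists2 k, outermost k & (i == k) || below i k.
Proof.
move=> /set0Pn[u ui].
have Pu : vle u u && [exists k, u \in A k].
  by rewrite vle_refl; apply/existsP; exists i.
case: (@arg_maxnP _ u (fun v => vle u v && [exists k, v \in A k]) (@height _ _ S) Pu).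
move=> v /andP[uv /existsP[k vk]] vmax; exists k.
  apply/andP; split; first by apply/set0Pn; exists v.
  apply/forallP => l; apply/negP => /[dup] bel /andP[kl /exists_inP[_ _ /exists_inP[v' v'l _]]].
  rewrite (belowE kl vk v'l) in bel.
  have : (height v' <= height v)%N.
    apply: vmax; rewrite (vle_trans uv bel)/=; apply/existsP; by exists l.
  rewrite leqNgt height_lt//; apply: contraNneq kl => vv'.
  by rewrite (chains_disj cA vk (j := l))// vv'.
by have [//|ik /=] := eqVneq i k; rewrite (belowE ik ui vk).
Qed.

(** The segments contain the chains of [k], and adding edges increases the gain. The
    labels below [k] restrict to a coupling of the subtrees, whose distance it bounds
    from above. *)
Lemma saving_outermost k p q : bot p \in A k -> A k \subset segset p ->
  bot q \in B k -> B k \subset segset q ->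
  gain (mass (A k)) (mass (B k)) + \sum_(i | below i k) gain (mass (A i)) (mass (B i))
    <= saving (p, q).
Proof.
move=> pk Akp qk Bkq; rewrite /saving/= lerD//.
  rewrite !seg_wtE (mass_subset Akp) (mass_subset Bkq).
  exact: le_trans (gain_opl _ _ _) (gain_opr _ _ _).
pose A1 i := if below i k then A i else set0.
pose B1 i := if below i k then B i else set0.
have AB1 : coupling A1 B1.
  by apply: coupling_sub AB => i; rewrite /A1 /B1; case: ifP => // _; exact: sub0set.
have pA1 i : bot p \notin A1 i.
  rewrite /A1; case: ifP => [/andP[ik _]|_]; last by rewrite inE.
  by apply: contraNN ik => pi; exact/eqP/(chains_disj cA pi pk).
have qB1 i : bot q \notin B1 i.
  rewrite /B1; case: ifP => [/andP[ik _]|_]; last by rewrite inE.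
  by apply: contraNN ik => qi; exact/eqP/(chains_disj cB qi qk).
have := dE_le_coupling (coupling_subtree pA1 qB1 AB1).
rewrite lerBrDr -lerBrDl; apply: le_trans.
rewrite /total_gain big_mkcond/=; apply: ler_sum => i _; case: ifP => [ik|_]; last exact: gain_ge0.
have /andP[nik _] := ik.
have Ai : A1 i = A i by rewrite /A1 ik.
have Bi : B1 i = B i by rewrite /B1 ik.
rewrite !mass_subtree// ?Ai ?Bi// => u ui.
  by rewrite -(below_right nik ui qk).
by rewrite -(belowE nik ui pk).
Qed.

(** Outermost chains are pairwise incomparable, so the segments they span satisfy the
    leaf constraints. Each of the other labels is below an outermost one, and its gain
    is part of the savings on the corresponding subtrees. *)
Lemma variables_of_coupling : exists2 delta, delta \in K S S' &
  total_gain A B <= \sum_z (delta z)%:R * saving z.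
Proof.
pose J := {k : I | outermost k}.
have exz (k : J) : exists z : segment S * segment S',
    [/\ bot z.1 \in A (val k), top z.1 \in A (val k) & A (val k) \subset segset z.1] /\
    [/\ bot z.2 \in B (val k), top z.2 \in B (val k) & B (val k) \subset segset z.2].
  have /andP[Ak _] := valP k; have [p pP] := chain_segment cA Ak.
  have [|q qP] := @chain_segment _ _ B (val k) cB; first by rewrite -twoAB.
  by exists (p, q).
have [sg sgP] := choice exz.
have sgI : injective sg.
  move=> k k' e; apply: val_inj; have [[_ + _] _] := sgP k; have [[_ + _] _] := sgP k'.
  by rewrite e => tk' tk; exact: (chains_disj cA tk tk').
have nbelow (k k' : J) : ~~ below (val k) (val k').
  by have /andP[_ /forallP/(_ (val k'))] := valP k.
pose delta : variables S S' := [ffun z => z \in codom sg].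
exists delta.
  have incomp z z' : delta z -> delta z' -> z != z' ->
      ~~ vle (top z.1) (top z'.1) /\ ~~ vle (top z.2) (top z'.2).
    rewrite !ffunE => /codomP[k ->] /codomP[k' ->] neq.
    have kk' : val k != val k' by apply: contraNneq neq => /val_inj ->.
    have [[_ tk _] [_ sk _]] := sgP k; have [[_ tk' _] [_ sk' _]] := sgP k'.
    by rewrite -(belowE kk' tk tk') -(below_right kk' sk sk') !nbelow.
  rewrite inE; apply/andP; split.
    apply/(leaf_constraintP (fun p q => delta (p, q))) => p q p' q' dz dz' neq.
    by have [] := incomp _ _ dz dz' neq.
  apply/(leaf_constraintP (fun q p => delta (p, q))) => q p q' p' dz dz' neq.
  have neq' : (p, q) != (p', q') by apply: contraNneq neq => -[-> ->].
  by have [] := incomp _ _ dz dz' neq'.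
have -> : \sum_z (delta z)%:R * saving z = \sum_(k : J) saving (sg k).
  transitivity (\sum_(z in codom sg) saving z).
    rewrite [RHS]big_mkcond; apply: eq_bigr => z _; rewrite ffunE.
    by case: ifP; rewrite ?mul1r ?mul0r.
  transitivity (\sum_(z in sg @: [set: J]) saving z).
    apply: eq_bigl => z; apply/idP/idP => [/codomP[k ->]|/imsetP[k _ ->]].
      exact: imset_f.
    exact: codom_f.
  rewrite big_imset/=; last by move=> k k' _ _; exact: sgI.
  by apply: eq_bigl => k; rewrite inE.
pose g i := gain (mass (A i)) (mass (B i)).
apply: le_trans (_ : _ <= \sum_(k : J) (g (val k) + \sum_(i | below i (val k)) g i)) _; last first.
  apply: ler_sum => k _; have [[b1 _ s1] [b2 _ s2]] := sgP k.
  by rewrite [sg k]surjective_pairing; exact: saving_outermost.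
have -> : \sum_(k : J) (g (val k) + \sum_(i | below i (val k)) g i) =
    \sum_i \sum_(k : J) ((i == val k)%:R * g i + (below i (val k))%:R * g i).
  rewrite [RHS]exchange_big/=; apply: eq_bigr => k _; rewrite [RHS]big_split/=; congr (_ + _).
    rewrite (bigD1 (val k))//= eqxx mul1r big1 ?addr0// => i /negbTE ->.
    by rewrite mul0r.
  by rewrite big_mkcond; apply: eq_bigr => i _; case: ifP; rewrite ?mul1r ?mul0r.
apply: ler_sum => i _; have g0 : 0 <= g i by exact: gain_ge0.
have t0 (k : J) : 0 <= (i == val k)%:R * g i + (below i (val k))%:R * g i.
  by rewrite addr_ge0// mulr_ge0.
have [Ai|Ai] := eqVneq (A i) set0.
  rewrite Ai mass0 gain0l; by apply: sumr_ge0 => k _; exact: t0.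
have [k ko ik] := outermost_above Ai.
rewrite (bigD1 (exist _ k ko : J))//=; apply: (@le_trans _ _ (g i)) => //.
rewrite -[leLHS]addr0; apply: lerD; last by apply: sumr_ge0 => k' _; exact: t0.
case/orP: ik => ->; rewrite mul1r.
  by rewrite lerDl mulr_ge0.
by rewrite lerDr mulr_ge0.
Qed.

End Outermost.

Definition objective (Tx Ty : dendrogram X) (delta : variables Tx Ty) : R :=
  FC delta + FD delta - Fm delta + FS delta.

Lemma variables_of_matching (Tx Ty : dendrogram X) (M : matching Tx Ty) :
  exists2 delta, delta \in K Tx Ty & objective delta <= dnorm Tx + dnorm Ty - mgain M.
Proof.
case: M => I A0 B0 AB0; rewrite /mgain/=.
have [A [B [AB twoAB <-]]] := coupling_two_sided AB0.
have [delta dK gd] := variables_of_coupling AB twoAB.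
by exists delta => //; rewrite /objective objectiveE lerD2l lerN2.
Qed.

(** Distances are infima, so the couplings of the subtrees are chosen up to an error,
    small enough to be repeated once for each pair of segments. *)
Lemma dE_le_objective (Tx Ty : dendrogram X) (delta : variables Tx Ty) :
  delta \in K Tx Ty -> dE Tx Ty <= objective delta.
Proof.
rewrite inE => /andP[/(leaf_constraintP (fun p q => delta (p, q))) inc1].
move=> /(leaf_constraintP (fun q p => delta (p, q))) inc2.
rewrite /objective objectiveE; apply/ler_addgt0Pr => e e0.
pose N := #|{: segment Tx * segment Ty}|.
pose e' := e / N.+1%:R; have e'0 : 0 < e' by rewrite divr_gt0.
pose M (z : segment Tx * segment Ty) :=
  projT1 (cid (matching_near_dE (sub (bot z.1)) (sub (bot z.2)) e'0)).
have MP (z : segment Tx * segment Ty) :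
    saving z <= gain (seg_wt z.1) (seg_wt z.2) + mgain (M z) + e'.
  have := projT2 (cid (matching_near_dE (sub (bot z.1)) (sub (bot z.2)) e'0)).
  by rewrite -/(M z) /saving; lra.
have [||I [A [B [AB gE]]]] :=
    @coupling_glue _ _ Tx Ty _ delta (fun z => z.1) (fun z => z.2) M.
- by move=> [p q] [p' q'] dz dz' neq; exact: inc1 dz dz' neq.
- move=> [p q] [p' q'] dz dz' neq; apply: inc2 dz dz' _.
  by apply: contraNneq neq => -[-> ->].
apply: le_trans (dE_le_coupling AB) _; rewrite gE.
suff le_e : \sum_z (delta z)%:R * saving z <=
    \sum_(z | delta z) (gain (seg_wt z.1) (seg_wt z.2) + mgain (M z)) + e by lra.
apply: le_trans (_ : _ <= \sum_z ((if delta z then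
    gain (seg_wt z.1) (seg_wt z.2) + mgain (M z) else 0) + e')) _.
  apply: ler_sum => z _; have := MP z; case: (delta z); rewrite ?mul1r ?mul0r//.
  by move=> _; rewrite add0r ltW.
rewrite big_split/= -big_mkcond lerD2l sumr_const -/N -mulr_natr /e' mulrAC.
by rewrite ler_pdivrMr ?ltr0n// ler_wpM2l ?ltW// ltr_nat.
Qed.

Lemma dE_objective_min (Tx Ty : dendrogram X) :
  exists2 delta, delta \in K Tx Ty & dE Tx Ty = objective delta.
Proof.
have [delta0 d0 _] := variables_of_matching (Matching (empty_coupling Tx Ty)).
case: (@arg_minP _ _ _ delta0 (mem (K Tx Ty)) (@objective Tx Ty) d0) => delta dK dmin.
exists delta => //; apply/eqP; rewrite eq_le dE_le_objective//=.
apply: dE_ge_matchings => M; have [delta' d'K] := variables_of_matching M.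
by apply: le_trans; exact: dmin.
Qed.

End FromCouplings.

Theorem proposition8 (R : realType) (X : editableSpace R)
    (T T' : dendrogram X) (hT : no_degree2 T) (hT' : no_degree2 T')
    (x : T) (y : T') :
  let Tx := sub x in
  let Ty := sub y in
  (exists2 delta, delta \in K Tx Ty
     & dE Tx Ty = FC delta + FD delta - Fm delta + FS delta) /\
  (forall delta, delta \in K Tx Ty ->
     dE Tx Ty <= FC delta + FD delta - Fm delta + FS delta).
Proof.
by move=> Tx Ty; split; [exact: dE_objective_min|exact: dE_le_objective].
Qed.
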